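(* Let $G$ be a finite group, $k$ an algebraically closed field of characteristic zero, and $\omega$ a normalized $3$-cocycle on $G$ with values in $k^\times$. Let $K,H,K',H'$ be normal subgroups of $G$ such that $K$ and $H$ centralize each other and $K'$ and $H'$ centralize each other, and let $B:K\times H\to k^\times$ and $B':K'\times H'\to k^\times$ be $G$-invariant $\omega$-bicharacters. Then, in $\operatorname{Rep}(D^\omega(G))$: (i) $\mathcal{S}(K,H,B)\cap\mathcal{S}(K',H',B')=\mathcal{S}(\ker\varphi_{B,B'},\,HH',\,\psi_{B,B'})$; (ii) $\mathcal{S}(K,H,B)\vee\mathcal{S}(K',H',B')=\mathcal{S}(KK',\,\ker\varphi_{B^{\mathrm{op}},(B')^{\mathrm{op}}},\,(\psi_{B^{\mathrm{op}},(B')^{\mathrm{op}}})^{\mathrm{op}})$.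
   Context: A normalized 3-cocycle is a map $\omega:G^3\to k^\times$ with $\omega(g_2,g_3,g_4)\,\omega(g_1,g_2g_3,g_4)\,\omega(g_1,g_2,g_3)=\omega(g_1g_2,g_3,g_4)\,\omega(g_1,g_2,g_3g_4)$ and $\omega(g,e,l)=1$ ($e$ the identity of $G$). For $a,x,y\in G$ put $\beta_a(x,y)=\frac{\omega(a,x,y)\,\omega(x,y,y^{-1}x^{-1}axy)}{\omega(x,x^{-1}ax,y)}$ and $\gamma_a(x,y)=\frac{\omega(x,y,a)\,\omega(a,a^{-1}xa,a^{-1}ya)}{\omega(x,a,a^{-1}ya)}$. $D^\omega(G)$ is the Dijkgraaf--Pasquier--Roche quasi-triangular quasi-Hopf algebra with basis $\{\delta_g\overline{x}\}_{g,x\in G}$, product $(\delta_g\overline{x})(\delta_h\overline{y})=\beta_g(x,y)\,\delta_g\overline{xy}$ if $h=x^{-1}gx$ and $0$ otherwise, coproduct $\Delta(\delta_g\overline{x})=\sum_{hl=g}\gamma_x(h,l)\,\delta_h\overline{x}\otimes\delta_l\overline{x}$, associator $\sum\omega(g,h,l)^{-1}\delta_g\overline{e}\otimes\delta_h\overline{e}\otimes\delta_l\overline{e}$, and $R$-matrix $\sum_{g,h}\delta_g\overline{e}\otimes\delta_h\overline{g}$. $\operatorname{Rep}(D^\omega(G))$ (finite-dimensional modules) is a modular category, braided equivalent to the center of $\operatorname{Vec}_G^\omega$. Let $R$ be a set of representatives of the conjugacy classes of $G$. A $\beta_a$-character of $C_G(a)$ is the trace function of a finite-dimensional module over the twisted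 group algebra $k^{\beta_a}[C_G(a)]$ (basis $\overline{x}$, $\overline{x}\,\overline{y}=\beta_a(x,y)\overline{xy}$); $\deg\chi=\chi(e)$. Isomorphism classes of simple objects are identified with pairs $(a,\chi)$, $a\in R$, $\chi$ an irreducible $\beta_a$-character of $C_G(a)$: $(a,\chi)$ is the simple module $M$ with $\delta_a\overline{e}M\ne0$ on which $\operatorname{span}\{\delta_a\overline{x}:x\in C_G(a)\}\cong k^{\beta_a}[C_G(a)]$ acts on $\delta_a\overline{e}M$ with character $\chi$. For normal subgroups $K,H$ of $G$ that centralize each other (commute elementwise), $B:K\times H\to k^\times$ is an $\omega$-bicharacter if $B(x,yz)=\beta_x(y,z)^{-1}B(x,y)B(x,z)$ and $B(wx,y)=\beta_y(w,x)B(w,y)B(x,y)$ for all $w,x\in K$, $y,z\in H$; it is $G$-invariant if $B(x^{-1}kx,h)=\frac{\beta_k(x,h)\beta_k(xh,x^{-1})}{\beta_k(x,x^{-1})}B(k,xhx^{-1})$ for all $x\in G,k\in K,h\in H$. $\mathcal{S}(K,H,B)$ is the full subcategory of $\operatorname{Rep}(D^\omega(G))$ whose objects are the finite direct sums of simple objects $(a,\chi)$ with $a\in K\cap R$ and $\chi(h)=B(a,h)\deg\chi$ for all $h\in H$; it is a fusion subcategory (full, closed under isomorphism, direct sums, summands, tensor products, duals, containing the unit). $\varphi_{B,B'}:K\cap K'\to\widehat{H\cap H'}=\operatorname{Hom}(H\cap H',k^\times)$ is the group homomorphism $\varphi_{B,B'}(a)=B(a,\cdot)|_{H\cap H'}\,B'(a,\cdot)^{-1}|_{H\cap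 H'}$. $\psi_{B,B'}:\ker\varphi_{B,B'}\times HH'\to k^\times$ is the (well-defined) $G$-invariant $\omega$-bicharacter $\psi_{B,B'}(a,hh')=\beta_a(h,h')^{-1}B(a,h)B'(a,h')$ for $a\in\ker\varphi_{B,B'}$, $h\in H$, $h'\in H'$. For a function $F$ on $X\times Y$, $F^{\mathrm{op}}(y,x)=F(x,y)$. The functions $B^{\mathrm{op}},(B')^{\mathrm{op}}$ are $\omega^{-1}$-bicharacters, and the constructions $\varphi,\psi$ are applied to them with $\omega^{-1}$ in place of $\omega$; explicitly, $\varphi_{B^{\mathrm{op}},(B')^{\mathrm{op}}}:H\cap H'\to\widehat{K\cap K'}$ sends $a$ to $B(\cdot,a)B'(\cdot,a)^{-1}|_{K\cap K'}$, and $(\psi_{B^{\mathrm{op}},(B')^{\mathrm{op}}})^{\mathrm{op}}(kk',a)=\beta_a(k,k')B(k,a)B'(k',a)$ for $k\in K$, $k'\in K'$, $a\in\ker\varphi_{B^{\mathrm{op}},(B')^{\mathrm{op}}}$. $\mathcal{A}\vee\mathcal{B}$ is the fusion subcategory generated by $\mathcal{A}$ and $\mathcal{B}$. *)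

(* Defs.v *)
From HB Require Import structures.
From mathcomp Require Import all_boot all_order all_algebra all_fingroup.
From mathcomp Require Import mxtens.
From mathcomp Require Import ring.

Set Implicit Arguments.
Unset Strict Implicit.
Unset Printing Implicit Defensive.

Import GRing.Theory.
Local Open Scope ring_scope.

Section Cochains.
Variables (gT : finGroupType) (k : fieldType).

Definition is_cocycle3 (w : gT -> gT -> gT -> k) : Prop :=
  forall g1 g2 g3 g4 : gT,
    w g2 g3 g4 * w g1 (g2 * g3)%g g4 * w g1 g2 g3
    = w (g1 * g2)%g g3 g4 * w g1 g2 (g3 * g4)%g.

Record cocycle3 := Cocycle3 {
  cocycle_fun :> gT -> gT -> gT -> k;
  cocycle_neq0 : forall g h l, cocycle_fun g h l != 0;
  cocycleP : is_cocycle3 cocycle_fun;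
  cocycle_normalized : forall g l, cocycle_fun g 1%g l = 1 }.

Section Bicharacters.
Variable w : gT -> gT -> gT -> k.

Definition beta (a x y : gT) : k :=
  w a x y * w x y (a ^ (x * y))%g / w x (a ^ x)%g y.

Definition gamma (a x y : gT) : k :=
  w x y a * w a (x ^ a)%g (y ^ a)%g / w x a (y ^ a)%g.

(* Functions on K x H are represented by total functions on gT x gT of which
   only the values on K x H are constrained or used. *)
Definition bicharacter (K H : {set gT}) (B : gT -> gT -> k) : Prop :=
  [/\ {in K & H, forall x y, B x y != 0},
      forall x y z, x \in K -> y \in H -> z \in H ->
        B x (y * z)%g = (beta x y z)^-1 * B x y * B x z
    & forall v x y, v \in K -> x \in K -> y \in H ->
        B (v * x)%g y = beta y v x * B v y * B x y].

Definition G_invariant (K H : {set gT}) (B : gT -> gT -> k) : Prop :=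
  forall x c h, c \in K -> h \in H ->
    B (x^-1 * c * x)%g h
    = beta c x h * beta c (x * h)%g x^-1%g / beta c x x^-1%g
      * B c (x * h * x^-1)%g.

(* The value at h of the character phi_{B,B'}(a) of the intersection H n H'. *)
Definition phi (B B' : gT -> gT -> k) (a h : gT) : k := B a h * (B' a h)^-1.

Definition ker_phi (K H : {set gT}) (B : gT -> gT -> k)
    (K' H' : {set gT}) (B' : gT -> gT -> k) : {set gT} :=
  [set a in K :&: K' | [forall h in H :&: H', phi B B' a h == 1]].

(* divgr H H' y \in H and remgr H H' y \in H' are the factors of a chosen
   decomposition of y \in H * H'; see psiE for independence of that choice. *)
Definition psi (H : {set gT}) (B : gT -> gT -> k)
    (H' : {set gT}) (B' : gT -> gT -> k) (a y : gT) : k :=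
  let h := divgr H H' y in let h' := remgr H H' y in
  (beta a h h')^-1 * B a h * B' a h'.

End Bicharacters.

Definition opf (F : gT -> gT -> k) : gT -> gT -> k := fun y x => F x y.

End Cochains.

Section CocycleIdentities.
Variables (gT : finGroupType) (k : fieldType) (w : cocycle3 gT k).

Let w0 := cocycle_neq0 w.

Lemma cocycle_1l g h : w 1%g g h = 1.
Proof.
have := cocycleP w 1%g 1%g g h; rewrite !mul1g !cocycle_normalized mulr1.
by move/(mulfI (w0 _ _ _)).
Qed.

Lemma cocycle_1r g h : w g h 1%g = 1.
Proof.
have := cocycleP w g h 1%g 1%g; rewrite !mulg1 !cocycle_normalized !mul1r -[RHS]mulr1.
by move/(mulfI (w0 _ _ _)).
Qed.

Lemma beta_neq0 a x y : beta w a x y != 0.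
Proof. by rewrite /beta !mulf_neq0 ?invr_eq0. Qed.

Lemma gamma_neq0 a x y : gamma w a x y != 0.
Proof. by rewrite /gamma !mulf_neq0 ?invr_eq0. Qed.

Lemma beta_1 x y : beta w 1%g x y = 1.
Proof.
by rewrite /beta !conj1g cocycle_1l cocycle_1r cocycle_normalized invr1 !mulr1.
Qed.

Lemma beta_1x a x : beta w a 1%g x = 1.
Proof.
by rewrite /beta mul1g conjg1 !cocycle_1l cocycle_normalized invr1 !mulr1.
Qed.

Let cr g1 g2 g3 g4 :=
  w g2 g3 g4 * w g1 (g2 * g3)%g g4 * w g1 g2 g3
  / (w (g1 * g2)%g g3 g4 * w g1 g2 (g3 * g4)%g).

Let cr1 g1 g2 g3 g4 : cr g1 g2 g3 g4 = 1.
Proof. by rewrite /cr cocycleP divff // mulf_neq0. Qed.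

Lemma beta_cocycle a x y z :
  beta w a x y * beta w a (x * y)%g z
  = beta w a x (y * z)%g * beta w (a ^ x)%g y z.
Proof.
transitivity (beta w a x y * beta w a (x * y)%g z
  / cr a x y z * cr x (a ^ x)%g y z / cr x y (a ^ (x * y))%g z
  * cr x y z (a ^ (x * (y * z)))%g); first by rewrite !cr1 !divr1 !mulr1.
rewrite /beta /cr -!conjgM !(mulgA x y z). 
have -> : (x * a ^ x = a * x)%g by rewrite -conjgC.
have -> : (y * a ^ (x * y) = a ^ x * y)%g by rewrite conjgM -conjgC.
have -> : (z * a ^ (x * y * z) = a ^ (x * y) * z)%g by rewrite conjgM -conjgC.
by field; rewrite !w0.
Qed.

Lemma beta_gamma h l x y :
  gamma w x h l * gamma w y (h ^ x)%g (l ^ x)%g * beta w h x y * beta w l x y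
  = beta w (h * l)%g x y * gamma w (x * y)%g h l.
Proof.
set LHS := (X in X = _).
transitivity (LHS / cr h l x y * cr h x (l ^ x)%g y / cr x (h ^ x)%g (l ^ x)%g y
  / cr h x y (l ^ (x * y))%g * cr x (h ^ x)%g y (l ^ (x * y))%g
  / cr x y (h ^ (x * y))%g (l ^ (x * y))%g);
  first by rewrite !cr1 !divr1 !mulr1.
rewrite /LHS /beta /gamma /cr -!conjgM !conjMg.
have eC c : (x * c ^ x = c * x)%g by rewrite -conjgC.
have eD c : (y * c ^ (x * y) = c ^ x * y)%g by rewrite conjgM -conjgC.
rewrite !eC !eD.
by field; rewrite !w0.
Qed.

Lemma gamma_1 h l : gamma w 1%g h l = 1.
Proof.
by rewrite /gamma !conjg1 cocycle_1l cocycle_1r cocycle_normalized invr1 !mulr1.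
Qed.

Lemma gamma_1l x l : gamma w x 1%g l = 1.
Proof.
by rewrite /gamma conj1g cocycle_normalized !cocycle_1l invr1 !mulr1.
Qed.

Let inv_neq0 g h l : (w g h l)^-1 != 0. Proof. by rewrite invr_eq0. Qed.

Let inv_cocycleP : is_cocycle3 (fun g h l => (w g h l)^-1).
Proof. by move=> g1 g2 g3 g4; rewrite -!invfM cocycleP. Qed.

Let inv_normalized g l : (w g 1%g l)^-1 = 1.
Proof. by rewrite cocycle_normalized invr1. Qed.

Definition inv_cocycle : cocycle3 gT k :=
  Cocycle3 inv_neq0 inv_cocycleP inv_normalized.

Lemma beta_inv a x y : beta inv_cocycle a x y = (beta w a x y)^-1.
Proof. by rewrite /beta /= !invfM. Qed.

Lemma bicharacter_op (K H : {set gT}) B :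
  bicharacter w K H B -> bicharacter inv_cocycle H K (opf B).
Proof.
case=> B0 Br Bl; split=> [x y Hx Ky|x y z Hx Ky Kz|v x y Hv Hx Ky].
- exact: B0.
- by rewrite /opf Bl // beta_inv invrK.
by rewrite /opf Br // beta_inv.
Qed.

Lemma psiE (K H K' H' : {group gT}) (B B' : gT -> gT -> k) a h h' :
  H \subset 'C(K)%g ->
  bicharacter w K H B -> bicharacter w K' H' B' ->
  a \in ker_phi K H B K' H' B' -> h \in H -> h' \in H' ->
  psi w H B H' B' a (h * h')%g = (beta w a h h')^-1 * B a h * B' a h'.
Proof.
move=> cKH [B0 Br _] [B'0 B'r _]; rewrite !inE.
case/andP=> /andP[Ka K'a] /forall_inP phi1 Hh H'h'; rewrite /psi.
have HHy : (h * h')%g \in (H * H')%g by exact: mem_mulg.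
move: (mem_divgr HHy) (mem_remgr HHy) (divgr_eq H H' (h * h')%g).
move: (divgr _ _ _) (remgr _ _ _) => h1 h1' Hh1 H'h1' eyy.
pose z := (h^-1 * h1)%g.
have eh1 : h1 = (h * z)%g by rewrite mulKVg.
have eh' : h' = (z * h1')%g by rewrite /z -mulgA -eyy mulKg.
have Hz : z \in H by rewrite groupM ?groupV.
have H'z : z \in H' by rewrite -(mulgK h1' z) -eh' groupM ?groupV.
have eB : B a z = B' a z.
  have /eqP eB : phi B B' a z == 1 by rewrite phi1 // inE Hz.
  by rewrite -[LHS](mulfVK (B'0 a z K'a H'z)) [X in X * _]eB mul1r.
have ah : (a ^ h = a)%g.
  by rewrite conjgE -(centP (subsetP cKH h Hh) a Ka) mulKg.
have := beta_cocycle a h z h1'; rewrite ah eh1 eh' Br // B'r // eB => e.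
have -> : (beta w a h (z * h1'))^-1 =
    (beta w a h z * beta w a (h * z) h1')^-1 * beta w a z h1'.
  by rewrite e; field; rewrite !beta_neq0.
by field; rewrite !beta_neq0.
Qed.

End CocycleIdentities.

Lemma tensmxDl (k : fieldType) m n p q (A A' : 'M[k]_(m, n)) (C : 'M[k]_(p, q)) :
  (A + A') *t C = A *t C + A' *t C.
Proof.
apply/matrixP=> i j; case: (mxtens_indexP i) => i1 i2.
by case: (mxtens_indexP j) => j1 j2; rewrite tensmxE [RHS]mxE !tensmxE mxE mulrDl.
Qed.

Lemma tensmxDr (k : fieldType) m n p q (C : 'M[k]_(m, n)) (A A' : 'M[k]_(p, q)) :
  C *t (A + A') = C *t A + C *t A'.
Proof.
apply/matrixP=> i j; case: (mxtens_indexP i) => i1 i2.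
by case: (mxtens_indexP j) => j1 j2; rewrite tensmxE [RHS]mxE !tensmxE mxE mulrDr.
Qed.

Lemma tensmxZ (k : fieldType) m n p q (a b : k) (A : 'M[k]_(m, n))
    (C : 'M[k]_(p, q)) : (a *: A) *t (b *: C) = (a * b) *: (A *t C).
Proof.
apply/matrixP=> i j; case: (mxtens_indexP i) => i1 i2.
by case: (mxtens_indexP j) => j1 j2; rewrite tensmxE [RHS]mxE tensmxE !mxE; ring.
Qed.

Lemma tensmx11 (k : fieldType) m n :
  (1%:M : 'M[k]_m) *t (1%:M : 'M[k]_n) = 1%:M.
Proof.
apply/matrixP=> i j; case: (mxtens_indexP i) => i1 i2.
case: (mxtens_indexP j) => j1 j2; rewrite tensmxE !mxE -natrM mulnb.
by rewrite (inj_eq (can_inj (@mxtens_indexK m n))) xpair_eqE.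
Qed.

Section Modules.
Variables (gT : finGroupType) (k : fieldType) (w : cocycle3 gT k).

(* A finite-dimensional left D^w(G)-module structure on the column vectors
   k^mdim: mact g x is the matrix of the basis element delta_g xbar. The two
   axioms are the multiplication table (here g ^ x = x^-1 g x) and the unit
   \sum_g delta_g ebar of D^w(G). *)
Record Dmod := DMod {
  mdim : nat;
  mact : gT -> gT -> 'M[k]_mdim;
  mactM : forall g x h y, mact g x *m mact h y
    = if h == (g ^ x)%g then beta w g x y *: mact g (x * y)%g else 0;
  mact1 : \sum_g mact g 1%g = 1%:M }.

Definition is_hom (M N : Dmod) (f : 'M[k]_(mdim N, mdim M)) : Prop :=
  forall g x, mact N g x *m f = f *m mact M g x.

Definition iso (M N : Dmod) : Prop :=
  exists (f : 'M[k]_(mdim N, mdim M)) (f' : 'M[k]_(mdim M, mdim N)),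
    [/\ is_hom f, is_hom f', f *m f' = 1%:M & f' *m f = 1%:M].

Definition zero_act (_ _ : gT) : 'M[k]_0 := 0.

Lemma zero_actM g x h y : zero_act g x *m zero_act h y
  = if h == (g ^ x)%g then beta w g x y *: zero_act g (x * y)%g else 0.
Proof. by rewrite (flatmx0 (_ *m _)) (flatmx0 (if _ then _ else _)). Qed.

Lemma zero_act1 : \sum_g zero_act g 1%g = 1%:M.
Proof. by rewrite (flatmx0 1%:M) (flatmx0 (\sum_g _)). Qed.

Definition zero_mod : Dmod := DMod zero_actM zero_act1.

Section DirectSum.
Variables M N : Dmod.

Definition dsum_act (g x : gT) : 'M[k]_(mdim M + mdim N) :=
  block_mx (mact M g x) 0 0 (mact N g x).

Lemma dsum_actM g x h y : dsum_act g x *m dsum_act h y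
  = if h == (g ^ x)%g then beta w g x y *: dsum_act g (x * y)%g else 0.
Proof.
rewrite mulmx_block !mulmx0 !mul0mx !addr0 !add0r !mactM.
by case: eqP => _; rewrite ?block_mx0 // scale_block_mx !scaler0.
Qed.

Lemma dsum_act1 : \sum_g dsum_act g 1%g = 1%:M.
Proof.
have -> : \sum_g dsum_act g 1%g =
    block_mx (\sum_g mact M g 1%g) 0 0 (\sum_g mact N g 1%g).
  elim/big_rec3: _ => [|g y1 y2 y3 _ ->]; first by rewrite block_mx0.
  by rewrite add_block_mx !addr0.
by rewrite !mact1 -scalar_mx_block.
Qed.

Definition dsum : Dmod := DMod dsum_actM dsum_act1.

End DirectSum.

Definition unit_act (g _ : gT) : 'M[k]_1 := (g == 1%g)%:R%:M.

Lemma unit_actM g x h y : unit_act g x *m unit_act h y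
  = if h == (g ^ x)%g then beta w g x y *: unit_act g (x * y)%g else 0.
Proof.
rewrite -scalar_mxM scale_scalar_mx.
have [-> | g1] := eqVneq g 1%g.
  by rewrite conj1g beta_1 !mul1r; case: eqP => // _; rewrite raddf0.
by rewrite mul0r mulr0 raddf0 if_same.
Qed.

Lemma unit_act1 : \sum_g unit_act g 1%g = 1%:M.
Proof.
rewrite (bigD1 1%g) //= big1 ?addr0 /unit_act ?eqxx // => g /negPf->.
by rewrite raddf0.
Qed.

Definition unit_mod : Dmod := DMod unit_actM unit_act1.

Section Tensor.
Variables M N : Dmod.

Definition tens_act (g x : gT) : 'M[k]_(mdim M * mdim N) :=
  \sum_(p : gT * gT | (p.1 * p.2)%g == g)
    gamma w x p.1 p.2 *: (mact M p.1 x *t mact N p.2 x).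

Lemma tens_actM g x h y : tens_act g x *m tens_act h y
  = if h == (g ^ x)%g then beta w g x y *: tens_act g (x * y)%g else 0.
Proof.
rewrite mulmx_suml.
have tE p : (gamma w x p.1 p.2 *: (mact M p.1 x *t mact N p.2 x)) *m tens_act h y
    = if h == ((p.1 * p.2) ^ x)%g then beta w (p.1 * p.2)%g x y *:
        (gamma w (x * y)%g p.1 p.2 *: (mact M p.1 (x * y)%g *t mact N p.2 (x * y)%g))
      else 0.
  case: p => u v /=; rewrite mulmx_sumr.
  have qE q : gamma w x u v *: (mact M u x *t mact N v x)
      *m (gamma w y q.1 q.2 *: (mact M q.1 y *t mact N q.2 y))
    = if q == (u ^ x, v ^ x)%g then beta w (u * v)%g x y *:
        (gamma w (x * y)%g u v *: (mact M u (x * y)%g *t mact N v (x * y)%g))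
      else 0.
    rewrite -scalemxAl -scalemxAr tensmx_mul !mactM; case: q => q1 q2 /=.
    rewrite xpair_eqE; have [-> | _] /= := eqVneq q1 _; last first.
      by rewrite tens0mx !scaler0.
    have [-> | _] /= := eqVneq q2 _; last by rewrite tensmx0 !scaler0.
    by rewrite tensmxZ !scalerA -beta_gamma !mulrA.
  rewrite (eq_bigr _ (fun q _ => qE q)) -big_mkcondr /=.
  have [-> | neq] := eqVneq h _.
    rewrite (big_pred1 (u ^ x, v ^ x)%g) // => -[q1 q2] /=.
    rewrite conjMg; apply: andb_idl => /eqP[-> ->]; exact: eqxx.
  rewrite big_pred0 // => -[q1 q2] /=; apply/andP=> -[/eqP e /eqP[e1 e2]].
  by move: neq; rewrite -e e1 e2 conjMg eqxx.
rewrite (eq_bigr _ (fun p _ => tE p)).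
transitivity (\sum_(p : gT * gT | (p.1 * p.2)%g == g)
   if h == (g ^ x)%g then beta w g x y *:
      (gamma w (x * y)%g p.1 p.2 *: (mact M p.1 (x * y)%g *t mact N p.2 (x * y)%g))
      else 0).
  by apply: eq_bigr => p /eqP->.
case: eqP => _; last by rewrite big1.
by rewrite -scaler_sumr.
Qed.

Lemma tens_act1 : \sum_g tens_act g 1%g = 1%:M.
Proof.
transitivity (\sum_(p : gT * gT) mact M p.1 1%g *t mact N p.2 1%g).
  rewrite [RHS](partition_big (fun p : gT * gT => (p.1 * p.2)%g) predT) //=.
  by apply: eq_bigr => g _; apply: eq_bigr => p _; rewrite gamma_1 scale1r.
rewrite -(pair_bigA _ (fun u v => mact M u 1%g *t mact N v 1%g)) /=.
transitivity ((\sum_u mact M u 1%g) *t (\sum_v mact N v 1%g)); last first.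
  by rewrite !mact1 tensmx11.
rewrite (big_morph (fun A => A *t _) (fun A A' => tensmxDl A A' _) (tens0mx _)).
apply: eq_bigr => u _.
by rewrite (big_morph _ (tensmxDr _) (tensmx0 _)).
Qed.

Definition tens : Dmod := DMod tens_actM tens_act1.

End Tensor.

Section Duals.
Variables X Y Z : Dmod.

(* The associativity isomorphism (X (x) Y) (x) Z -> X (x) (Y (x) Z), i.e. the
   action of the associator of D^w(G), and its inverse. The cast by mulnA
   implements the rebracketing: both mxtens_index orders enumerate the basis
   e_i (x) e_j (x) e_l in the same order. *)
Definition assoc_mx :
    'M[k]_(mdim X * (mdim Y * mdim Z), mdim X * mdim Y * mdim Z) :=
  castmx (esym (mulnA _ _ _), erefl)
    (\sum_g \sum_h \sum_l (w g h l)^-1 *: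
       (mact X g 1%g *t mact Y h 1%g *t mact Z l 1%g)).

Definition assoc_inv_mx :
    'M[k]_(mdim X * mdim Y * mdim Z, mdim X * (mdim Y * mdim Z)) :=
  castmx (erefl, esym (mulnA _ _ _))
    (\sum_g \sum_h \sum_l w g h l *:
       (mact X g 1%g *t mact Y h 1%g *t mact Z l 1%g)).

End Duals.

(* Y is a left dual of X: there are evaluation Y (x) X -> 1 and coevaluation
   1 -> X (x) Y morphisms satisfying the two zigzag identities. The unit
   constraints of Rep(D^w(G)) are the identifications 1 * n = n = n * 1. *)
Definition left_dual (Y X : Dmod) : Prop :=
  exists (ev : 'M[k]_(1, mdim Y * mdim X)) (coev : 'M[k]_(mdim X * mdim Y, 1)),
  [/\ is_hom (M := tens Y X) (N := unit_mod) ev,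
      is_hom (M := unit_mod) (N := tens X Y) coev,
      castmx (muln1 _, mul1n _)
        ((1%:M *t ev) *m assoc_mx X Y X *m (coev *t 1%:M))
      = 1%:M :> 'M_(mdim X)
    & castmx (mul1n _, muln1 _)
        ((ev *t 1%:M) *m assoc_inv_mx Y X Y *m (1%:M *t coev))
      = 1%:M :> 'M_(mdim Y)].

(* A full subcategory of Rep(D^w(G)) is given by its class of objects. *)
Definition subcat := Dmod -> Prop.

Definition same_subcat (A C : subcat) : Prop := forall M, A M <-> C M.

Definition subcat_sub (A C : subcat) : Prop := forall M, A M -> C M.

Definition subcat_meet (A C : subcat) : subcat := fun M => A M /\ C M.

Record fusion_subcat (A : subcat) : Prop := FusionSubcat {
  fusion_iso : forall M N, iso M N -> A M -> A N;
  fusion_unit : A unit_mod;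
  fusion_dsum : forall M N, A M -> A N -> A (dsum M N);
  fusion_summand : forall M N, A (dsum M N) -> A M;
  fusion_tens : forall M N, A M -> A N -> A (tens M N);
  fusion_left_dual : forall X Y, left_dual Y X -> A X -> A Y;
  fusion_right_dual : forall X Y, left_dual X Y -> A X -> A Y }.

(* The fusion subcategory generated by A and C. *)
Definition subcat_join (A C : subcat) : subcat := fun M =>
  forall E : subcat, fusion_subcat E -> subcat_sub A E -> subcat_sub C E -> E M.

Definition simple_mod (M : Dmod) : Prop :=
  (0 < mdim M)%N /\
  forall W : {vspace 'cV[k]_(mdim M)},
    (forall g x v, v \in W -> mact M g x *m v \in W) -> W = 0%VS \/ W = fullv.

(* n-dimensional modules over the twisted group algebra k^{beta_a}[C_G(a)];
   the values of rho outside of the centralizer are irrelevant. *)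
Definition twisted_mod (a : gT) n (rho : gT -> 'M[k]_n) : Prop :=
  rho 1%g = 1%:M /\
  {in 'C[a]%g &, forall x y, rho x *m rho y = beta w a x y *: rho (x * y)%g}.

Definition irr_twisted_mod (a : gT) n (rho : gT -> 'M[k]_n) : Prop :=
  [/\ twisted_mod a rho, (0 < n)%N
    & forall W : {vspace 'cV[k]_n},
        (forall x v, x \in 'C[a]%g -> v \in W -> rho x *m v \in W) ->
        W = 0%VS \/ W = fullv].

Definition irr_beta_char (a : gT) (chi : gT -> k) : Prop :=
  exists (n : nat) (rho : gT -> 'M[k]_n),
    irr_twisted_mod a rho /\ {in 'C[a]%g, forall x, chi x = \tr (rho x)}.

(* For x in C_G(a), the matrix of delta_a xbar acting on the subspace
   (delta_a ebar) M. The columns of col_base e are a basis of the image of the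
   idempotent e = mact M a 1 and, as e = col_base e *m row_base e, the product
   row_base e *m v is the coordinate vector in that basis of v in the image. *)
Definition fiber (M : Dmod) (a x : gT) : 'M[k]_(\rank (mact M a 1%g)) :=
  row_base (mact M a 1%g) *m mact M a x *m col_base (mact M a 1%g).

(* M is a simple object labelled by (a, chi). *)
Definition simple_obj (a : gT) (chi : gT -> k) (M : Dmod) : Prop :=
  [/\ simple_mod M, mact M a 1%g != 0
    & {in 'C[a]%g, forall x, \tr (fiber M a x) = chi x}].

(* The objects of S(K, H, B), for R the chosen set of representatives of the
   conjugacy classes. *)
Definition S_subcat (R K H : {set gT}) (B : gT -> gT -> k) : subcat := fun M =>
  exists (n : nat) (N : 'I_n -> Dmod),
    iso M (\big[dsum/zero_mod]_(i < n) N i) /\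
    forall i, exists (a : gT) (chi : gT -> k),
      [/\ a \in K :&: R, irr_beta_char a chi, simple_obj a chi (N i)
        & {in H, forall h, chi h = B a h * chi 1%g}].

End Modules.

Arguments S_subcat {gT k} w R K H B _.

(* Main.v *)
(** The idea is to replace the condition on characters defining S(K,H,B) by a
linear one: a module M lies in S(K,H,B) iff delta_g hbar acts as B(g,h) delta_g
ebar for g in K and as 0 for g outside of K, for all h in H (S_acts). One
direction is semisimplicity. For the other, the average over H of the
B(g,h)^-1 delta_g hbar, summed over g in K, is a central idempotent by
G-invariance of B; on a simple object (a,chi) of S(K,H,B) the trace of its
product with delta_a ebar is chi(1) != 0, so it acts as the identity.

The intersection formula is then a computation. For the join, let X and Y be the
images of the idempotents of (K,H,B) and (K',H',B') on the regular module. As the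
characters of the group K n K' sum to 0 unless trivial, the character of X (x) Y
at delta_g xbar vanishes unless x is in the kernel, where it is a multiple of
psi^op(g,x); so its pairing with the character of any simple module of the
right-hand side is nonzero and that module is a summand of X (x) Y. The action on
X (x) Y also shows that psi^op is a G-invariant bicharacter in its second
variable, whence the right-hand side is a fusion subcategory. *)

From Pilot Require (* all_fingroup also defines mact: restore the one of Defs. *)
Import Defs.
From HB Require Import structures.
From mathcomp Require Import all_boot all_order all_algebra all_fingroup.
From mathcomp Require Import mxtens ring zify.
From Stdlib Require Import Classical.
Import Defs.

Set Implicit Arguments.
Unset Strict Implicit.
Unset Printing Implicit Defensive.

Import GRing.Theory.
Local Open Scope ring_scope.

(** * Matrix preliminaries *)

Lemma eq_col_mx (R : Type) m n (A A' : 'M[R]_(m, n)) :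
  (forall j, col j A = col j A') -> A = A'.
Proof. by move=> e; apply/matrixP=> i j; have /colP/(_ i) := e j; rewrite !mxE. Qed.

(** With [c = col_base e] and [r = row_base e], idempotence reads [c r c r = c r]; [c] cancels on
    the left and [r] on the right. *)
Lemma row_col_base (k : fieldType) n (e : 'M[k]_n) : e *m e = e ->
  row_base e *m col_base e = 1%:M.
Proof.
move=> ee; apply: (row_free_inj (row_base_free e)); rewrite mul1mx.
have qs : pinvmx (col_base e) *m col_base e = 1%:M.
  by rewrite mulVpmx ?col_base_full.
have := congr1 (mulmx (pinvmx (col_base e))) ee.
rewrite -[X in X *m X](mulmx_base e) -[X in _ = _ *m X](mulmx_base e).
by rewrite -mulmxA !(mulmxA _ (col_base e)) qs !mul1mx mulmxA => ->.
Qed.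

(** * Identities for the multiplication cocycle [beta] *)

Section Beta.
Variables (gT : finGroupType) (k : fieldType) (w : cocycle3 gT k).

Lemma conjg_commute (x y : gT) : commute x y -> (x ^ y = x)%g.
Proof. by move=> e; rewrite conjgE e mulKg. Qed.

Lemma commute_cent (A B : {set gT}) x y :
  A \subset 'C(B)%g -> x \in A -> y \in B -> commute x y.
Proof. by move=> cAB Ax By; apply: (centP (subsetP cAB x Ax)). Qed.

Lemma beta_x1 a x : beta w a x 1%g = 1.
Proof.
by rewrite /beta mulg1 !cocycle_1r cocycle_normalized invr1 !mulr1.
Qed.

(** With the conjugations gone, the two cochains have the same three factors. This turns coproduct
    coefficients into the cocycle governing left multiplicativity of bicharacters. *)
Lemma gamma_commute t u v : commute t u -> commute t v ->
  gamma w t u v = beta w t u v.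
Proof.
move=> tu tv; rewrite /beta /gamma conjgM.
rewrite (conjg_commute tu) (conjg_commute tv).
rewrite (conjg_commute (commute_sym tu)) (conjg_commute (commute_sym tv)).
by congr (_ / _); exact: mulrC.
Qed.

(** This and [beta_div2] match coefficients in [average_hom] after a translation of the group
    variable. *)
Lemma beta_div a x y :
  (beta w a (x * y)%g (x * y)^-1%g)^-1 * beta w (a ^ (x * y))%g (x * y)^-1%g x
  = (beta w a (x * y)%g y^-1%g)^-1.
Proof.
have := beta_cocycle w a (x * y)%g (x * y)^-1%g x.
have -> : ((x * y)^-1 * x = y^-1)%g by rewrite invMg mulgKV.
rewrite mulgV beta_1x mulr1 => ->; field.
by rewrite !beta_neq0.
Qed.

Lemma beta_div2 a x y :
  (beta w (a ^ x)%g y y^-1%g)^-1 * beta w a x y = (beta w a (x * y)%g y^-1%g)^-1.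
Proof.
have := beta_cocycle w a x y y^-1%g.
rewrite mulgV beta_x1 mul1r => <-; field.
by rewrite !beta_neq0.
Qed.

End Beta.

Local Notation hom M N f := (@is_hom _ _ _ M N f).

(** * Averaging and submodules *)

Section Modules.
Variables (gT : finGroupType) (k : fieldType) (w : cocycle3 gT k).
Implicit Types M N L : Dmod w.

Lemma mactM1 M g x h : mact M g x *m mact M h 1%g
  = if h == (g ^ x)%g then mact M g x else 0.
Proof. by rewrite mactM mulg1 beta_x1 scale1r. Qed.

Lemma mact1M M g h y : mact M h 1%g *m mact M g y
  = if g == h then mact M h y else 0.
Proof. by rewrite mactM mul1g conjg1 beta_1x scale1r. Qed.

Lemma hom_comp M N L (f : 'M_(mdim N, mdim M)) (f' : 'M_(mdim L, mdim N)) :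
  hom M N f -> hom N L f' -> hom M L (f' *m f).
Proof. by move=> hf hf' g x; rewrite mulmxA hf' -!mulmxA hf. Qed.

Lemma hom_id M : hom M M 1%:M.
Proof. by move=> g x; rewrite mulmx1 mul1mx. Qed.

Lemma homB M N (f f' : 'M_(mdim N, mdim M)) :
  hom M N f -> hom M N f' -> hom M N (f - f').
Proof. by move=> hf hf' g x; rewrite mulmxBr mulmxBl hf hf'. Qed.

Lemma iso_sym M N : iso M N -> iso N M.
Proof. by case=> f [f' [? ? ? ?]]; exists f', f; split. Qed.

Definition retract L M := exists (s : 'M_(mdim M, mdim L)) (r : 'M_(mdim L, mdim M)),
  [/\ hom L M s, hom M L r & r *m s = 1%:M].

Lemma retract_trans L M N : retract L M -> retract M N -> retract L N.
Proof.
case=> s [r [hs hr rs]] [s' [r' [hs' hr' rs']]]; exists (s' *m s), (r *m r').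
split; try exact: hom_comp hs hs'; try exact: hom_comp hr' hr.
by rewrite mulmxA -(mulmxA r) rs' mulmx1.
Qed.

Lemma iso_retract M N : iso M N -> retract M N.
Proof. by case=> f [f' [? ? ? ?]]; exists f, f'. Qed.

Section Average.
Variables M N : Dmod w.

(** A Reynolds operator: the element delta_(g ^ x) of x^-1, divided by [beta w g x x^-1], inverts
    delta_g xbar up to the idempotent delta_g ebar. *)
Definition average (p : 'M[k]_(mdim N, mdim M)) : 'M[k]_(mdim N, mdim M) :=
  #|gT|%:R^-1 *: \sum_g \sum_x (beta w g x x^-1%g)^-1 *:
    (mact N g x *m p *m mact M (g ^ x)%g x^-1%g).

Lemma average_hom p : hom M N (average p).
Proof.
move=> h y; rewrite /average -scalemxAr -scalemxAl; congr (_ *: _).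
rewrite mulmx_sumr mulmx_suml.
(* Orthogonality of the idempotents leaves only [g = h ^ y] on the left and [g = h] on the right;
   the two sums over [x] then differ by the translation [x -> y * x]. *)
rewrite (bigD1 (h ^ y)%g) //= [X in _ + X = _]big1 ?addr0; last first.
  move=> g /negPf ne; rewrite mulmx_sumr big1 // => x _.
  by rewrite -scalemxAr !mulmxA mactM ne !mul0mx scaler0.
rewrite [RHS](bigD1 h) //= [X in _ = _ + X]big1 ?addr0; last first.
  move=> g /negPf ne; rewrite mulmx_suml big1 // => x _.
  by rewrite -scalemxAl -!mulmxA mactM conjgK eq_sym ne !mulmx0 scaler0.
rewrite mulmx_sumr mulmx_suml [RHS](reindex_inj (mulgI y)) /=.
apply: eq_bigr => x _.
rewrite -scalemxAr -scalemxAl -!mulmxA mactM conjgK eqxx !mulmxA mactM eqxx.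
rewrite -!scalemxAl -!scalemxAr !scalerA -conjgM beta_div2 beta_div.
by congr (_ *: (_ *m mact M _ _)); rewrite invMg mulgKV.
Qed.

End Average.

Hypothesis char0 : [pchar k] =i pred0.

Lemma pchar0_natr_eq0 n : (n%:R == 0 :> k) = (n == 0)%N.
Proof. by have /pcharf0P := char0; apply. Qed.

Lemma card_neq0 : #|gT|%:R != 0 :> k.
Proof. by rewrite pchar0_natr_eq0 -lt0n; apply/card_gt0P; exists 1%g. Qed.

(** Averaging keeps the linear left inverse [q] a left inverse: as [s] is a morphism, each summand
    times [s] becomes some delta_g ebar, and over all [g] and [x] these add up to [#|gT|] times the
    identity. *)
Lemma maschke M N (s : 'M_(mdim N, mdim M)) q :
  hom M N s -> q *m s = 1%:M -> retract M N.
Proof.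
move=> hs qs; exists s, (average q); split=> //; first exact: average_hom.
rewrite /average -scalemxAl mulmx_suml.
transitivity (#|gT|%:R^-1 *: \sum_g \sum_(x : gT) mact M g 1%g).
  congr (_ *: _); apply: eq_bigr => g _; rewrite mulmx_suml; apply: eq_bigr => x _.
  rewrite -scalemxAl -!mulmxA hs (mulmxA q) qs mul1mx mactM eqxx mulgV.
  by rewrite scalerA mulVf ?scale1r // beta_neq0.
under eq_bigr do rewrite sumr_const.
rewrite sumrMnl mact1 -scaler_nat scalerA mulVf ?scale1r //; exact: card_neq0.
Qed.

Lemma maschke_mono M N (s : 'M_(mdim N, mdim M)) :
  hom M N s -> (forall v : 'cV_(mdim M), s *m v = 0 -> v = 0) -> retract M N.
Proof.
move=> hs s_inj; apply: (maschke (q := pinvmx s) hs); apply: mulVpmx.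
(* The columns of the cokernel matrix are killed by [s], hence vanish, so [s] has full column
   rank. *)
have c0 : cokermx s = 0.
  apply: eq_col_mx => j; rewrite col0; apply: s_inj.
  by rewrite colE mulmxA mulmx_coker mul0mx.
by rewrite /row_full eqn_leq rank_leq_col -subn_eq0 -mxrank_coker c0 mxrank0.
Qed.

Definition invariant M (W : {vspace 'cV[k]_(mdim M)}) : Prop :=
  forall g x v, v \in W -> mact M g x *m v \in W.

Lemma invariant_submodule M (W : {vspace 'cV[k]_(mdim M)}) :
  invariant W -> exists L (s : 'M_(mdim M, mdim L)),
  [/\ hom L M s, mdim L = \dim W, retract L M &
      forall v : 'cV_(mdim L), s *m v \in W].
Proof.
move=> Winv; pose b := vbasis W.
(* The columns of [s] are a basis of [W] and [q] takes coordinates in it, so [s *m q] fixes [W]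
   pointwise. *)
pose s : 'M[k]_(mdim M, \dim W) := \matrix_(i, j) b`_j i 0.
pose q : 'M[k]_(\dim W, mdim M) := \matrix_(j, i) coord b j (delta_mx i 0).
have qE v j : (q *m v) j 0 = coord b j v.
  rewrite mxE {2}[v]matrix_sum_delta linear_sum; apply: eq_bigr => i _.
  by rewrite big_ord1 linearZ /= mxE mulrC.
have sE v : s *m v = \sum_j v j 0 *: b`_j.
  apply/colP=> i; rewrite mxE summxE; apply: eq_bigr => j _.
  by rewrite !mxE mulrC.
have sqW v : v \in W -> s *m (q *m v) = v.
  move=> /coord_vbasis {2}->; rewrite sE; apply: eq_bigr => j _.
  by rewrite qE.
have sW v : s *m v \in W.
  rewrite sE; apply: memv_suml => j _; apply: memvZ; apply: vbasis_mem.
  by rewrite mem_nth ?size_tuple.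
have qs : q *m s = 1%:M.
  apply/matrixP=> i j.
  have -> : (q *m s) i j = (q *m (s *m (delta_mx j 0 : 'cV_(\dim W)))) i 0.
    by rewrite mulmxA -colE [RHS]mxE.
  rewrite qE sE linear_sum (bigD1 j) //= big1 ?addr0.
    rewrite linearZ /= coord_free ?(basis_free (vbasisP W)) // !mxE !eqxx mul1r.
    by rewrite eq_sym.
  by move=> l /negPf lj; rewrite linearZ /= mxE lj mul0r.
pose act g x := q *m mact M g x *m s.
have sact g x : s *m act g x = mact M g x *m s.
  apply: eq_col_mx => j; rewrite !colE /act -!mulmxA sqW //.
  by apply: Winv; exact: sW.
have actM g x h y : act g x *m act h y
    = if h == (g ^ x)%g then beta w g x y *: act g (x * y)%g else 0.
  rewrite {1}/act -!mulmxA sact !mulmxA -(mulmxA q) mactM.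
  by case: eqP => _; rewrite ?mulmx0 ?mul0mx // -scalemxAr -scalemxAl.
have act1 : \sum_g act g 1%g = 1%:M.
  by rewrite /act -mulmx_suml -mulmx_sumr mact1 mulmx1 qs.
exists (DMod actM act1), s; have hs : hom (DMod actM act1) M s by move=> g x.
by split=> //; exact: maschke hs qs.
Qed.

Lemma idempotent_split n (f : 'M[k]_n) : f *m f = f ->
  exists m (s : 'M_(n, m)) (r : 'M_(m, n)), r *m s = 1%:M /\ s *m r = f.
Proof.
move=> ff; exists (\rank f), (col_base f), (row_base f).
by split; [exact: row_col_base | exact: mulmx_base].
Qed.

(** Splitting [f] as [s *m r], the compressed action [r *m mact M g x *m s] is multiplicative
    because [s *m r] commutes with the action. *)
Lemma image_dmod M (f : 'M_(mdim M)) : hom M M f -> f *m f = f ->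
  exists L (s : 'M_(mdim M, mdim L)) (r : 'M_(mdim L, mdim M)),
  [/\ hom L M s, hom M L r, r *m s = 1%:M & s *m r = f].
Proof.
move=> hf /idempotent_split[n [s [r [rs sr]]]].
pose act g x := r *m mact M g x *m s.
have sact g x : s *m act g x = mact M g x *m s.
  by rewrite /act !mulmxA sr -hf -sr -!mulmxA rs mulmx1.
have ract g x : act g x *m r = r *m mact M g x.
  by rewrite /act -!mulmxA sr hf -sr !mulmxA rs mul1mx.
have actM g x h y : act g x *m act h y
    = if h == (g ^ x)%g then beta w g x y *: act g (x * y)%g else 0.
  rewrite {1}/act -!mulmxA sact !mulmxA -(mulmxA r) mactM.
  by case: eqP => _; rewrite ?mulmx0 ?mul0mx // -scalemxAr -scalemxAl.
have act1 : \sum_g act g 1%g = 1%:M.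
  by rewrite /act -mulmx_suml -mulmx_sumr mact1 mulmx1 rs.
by exists (DMod actM act1), s, r; split=> // g x; rewrite /= ?sact ?ract.
Qed.

(** The complement is the image of the idempotent morphism [1 - s *m r]. *)
Lemma retract_complement L M : retract L M ->
  exists2 L', retract L' M & iso M (dsum L L').
Proof.
case=> s [r [hs hr rs]].
have hf : hom M M (1%:M - s *m r).
  by apply: homB; [exact: hom_id | exact: hom_comp hr hs].
have ff : (1%:M - s *m r) *m (1%:M - s *m r) = 1%:M - s *m r.
  by rewrite mulmxBl mul1mx mulmxBr mulmx1 -mulmxA (mulmxA r) rs mul1mx subrr subr0.
have [L' [s' [r' [hs' hr' r's' s'r']]]] := image_dmod hf ff.
exists L'; first by exists s', r'.
have r's : r' *m s = 0.
  rewrite -[r']mul1mx -r's' -!mulmxA (mulmxA s') s'r' mulmxBl mul1mx -mulmxA rs.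
  by rewrite mulmx1 subrr mulmx0.
have rs' : r *m s' = 0.
  rewrite -[s']mulmx1 -r's' (mulmxA s') s'r' mulmxA mulmxBr mulmx1 mulmxA rs.
  by rewrite mul1mx subrr mul0mx.
exists (col_mx r r'), (row_mx s s'); split.
- move=> g x /=; rewrite mul_block_col !mul0mx addr0 add0r mul_col_mx.
  by rewrite hr hr'.
- by move=> g x /=; rewrite mul_row_block !mulmx0 addr0 add0r mul_mx_row hs hs'.
- by rewrite mul_col_row rs r's' rs' r's -scalar_mx_block.
by rewrite mul_row_col s'r' addrC subrK.
Qed.

End Modules.

(** * Semisimplicity *)

Section Decomposition.
Variables (gT : finGroupType) (k : fieldType) (w : cocycle3 gT k).
Hypothesis char0 : [pchar k] =i pred0.
Implicit Types (M N L : Dmod w) (A : subcat w).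

Definition retract_closed A := forall L M, retract L M -> A M -> A L.

Lemma fusion_retract_closed A : fusion_subcat A -> retract_closed A.
Proof.
move=> fA L M /retract_complement[L' _ isoM] AM.
exact: fusion_summand fA _ _ (fusion_iso fA isoM AM).
Qed.

Lemma iso_trans M N L : iso M N -> iso N L -> iso M L.
Proof.
case=> f [g [hf hg fg gf]] [f' [g' [hf' hg' fg' gf']]].
exists (f' *m f), (g *m g'); split.
- exact: hom_comp hf hf'.
- exact: hom_comp hg' hg.
- by rewrite mulmxA -(mulmxA f') fg mulmx1.
by rewrite mulmxA -(mulmxA g) gf' mulmx1.
Qed.

Lemma iso_dsumr L M N : iso M N -> iso (dsum L M) (dsum L N).
Proof.
case=> f [g [hf hg fg gf]].
exists (block_mx 1%:M 0 0 f), (block_mx 1%:M 0 0 g); split.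
- move=> h x /=; rewrite !mulmx_block !mulmx0 !mul0mx !addr0 !add0r.
  by rewrite mul1mx mulmx1 hf.
- move=> h x /=; rewrite !mulmx_block !mulmx0 !mul0mx !addr0 !add0r.
  by rewrite mul1mx mulmx1 hg.
- by rewrite !mulmx_block !mulmx0 !mul0mx !addr0 !add0r mul1mx fg -scalar_mx_block.
by rewrite !mulmx_block !mulmx0 !mul0mx !addr0 !add0r mul1mx gf -scalar_mx_block.
Qed.

Lemma iso_zero_mod M : mdim M = 0 -> iso M (zero_mod w).
Proof.
move=> M0; exists 0, 0; split; try by move=> g x; rewrite mulmx0 mul0mx.
  by rewrite (flatmx0 (_ *m _)) (flatmx0 1%:M).
by rewrite mul0mx; apply/matrixP=> i; have := ltn_ord i; rewrite {2}M0.
Qed.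

Lemma dim_colvec n : dim 'cV[k]_n = n.
Proof. exact: muln1. Qed.

(** Strong induction on the dimension: a proper nonzero invariant subspace carries a smaller module,
    which is a retract by [maschke]. *)
Lemma simple_retract M : (0 < mdim M)%N ->
  exists2 L, simple_mod L & retract L M.
Proof.
have [n] := ubnP (mdim M); elim: n M => // n IHn M leMn M_gt0.
have [simM | /not_and_or[/(_ M_gt0) //|]] := classic (simple_mod M).
  exists M => //; exists 1%:M, 1%:M; split; rewrite ?mulmx1 //; exact: hom_id.
move=> not_min; have [W nW] := not_all_ex_not _ _ not_min.
have [Winv W_ne] := imply_to_and _ _ nW.
have [W0 Wfull] := not_or_and _ _ W_ne.
have [L [s [hs dimL LM _]]] := invariant_submodule char0 Winv.
have ltL : (mdim L < mdim M)%N.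
  rewrite dimL ltn_neqAle; apply/andP; split.
    apply/negP=> /eqP dW; apply: Wfull; apply/eqP.
    by rewrite eqEdim subvf dimvf dim_colvec dW leqnn.
  by have := dimvS (subvf W); rewrite dimvf dim_colvec.
have L_gt0 : (0 < mdim L)%N.
  by rewrite dimL lt0n dimv_eq0; apply/eqP.
have [L' simL' L'L] := IHn L (leq_trans ltL leMn) L_gt0.
by exists L' => //; apply: retract_trans L'L LM.
Qed.

(** Simple retracts are split off one at a time. Carrying along a retract-closed class [A] is how a
    criterion on a module descends to its simple summands. *)
Lemma semisimple A M : retract_closed A -> A M ->
  exists n (N : 'I_n -> Dmod w), iso M (\big[@dsum _ _ w/zero_mod w]_(i < n) N i) /\
  forall i, simple_mod (N i) /\ A (N i).
Proof.
move=> Ar; have [m] := ubnP (mdim M); elim: m M => // m IHm M leMm AM.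
have [M0 | M_gt0] := posnP (mdim M).
  exists 0%N, (fun=> M); split; last by case.
  by rewrite big_ord0; exact: iso_zero_mod.
have [L simL LM] := simple_retract M_gt0.
have [L' L'M isoM] := retract_complement LM.
have ltL' : (mdim L' < mdim M)%N.
  have [f [g [_ _ fg gf]]] := isoM.
  have := mulmx1_min fg; have := mulmx1_min gf; case: simL => L0 _ /=; lia.
have [n [N [isoL' simN]]] := IHm L' (leq_trans ltL' leMm) (Ar _ _ L'M AM).
exists n.+1, (fun i => oapp N L (unlift ord0 i)); split.
  rewrite big_ord_recl unlift_none /=.
  under eq_bigr do rewrite liftK /=.
  exact: iso_trans isoM (iso_dsumr _ isoL').
by move=> i; case: unliftP => [j|] _ /=; [exact: simN | split=> //; exact: Ar LM AM].
Qed.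

End Decomposition.

(** * A linear criterion for membership in S(K,H,B) *)

Section Criterion.
Variables (gT : finGroupType) (k : fieldType) (w : cocycle3 gT k).
Hypothesis char0 : [pchar k] =i pred0.
Implicit Types (M N L : Dmod w) (A : subcat w) (B : gT -> gT -> k).

Definition S_acts (K H : {set gT}) B M : Prop := forall g h, h \in H ->
  mact M g h = if g \in K then B g h *: mact M g 1%g else 0.

Lemma S_acts_retract K H B : retract_closed (w := w) (S_acts K H B).
Proof.
move=> L M [s [r [hs hr rs]]] aM g h Hh.
have E x : mact L g x = r *m mact M g x *m s.
  by rewrite -mulmxA hs mulmxA rs mul1mx.
rewrite !E aM //; case: ifP => _; last by rewrite mulmx0 mul0mx.
by rewrite -scalemxAr -scalemxAl.
Qed.

Lemma S_acts_zero K H B : S_acts K H B (zero_mod w).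
Proof. by move=> g h _; rewrite [LHS]flatmx0 [RHS]flatmx0. Qed.

Lemma S_acts_dsum K H B M N :
  S_acts K H B M -> S_acts K H B N -> S_acts K H B (dsum M N).
Proof.
move=> aM aN g h Hh; rewrite /= /dsum_act aM // aN //.
by case: ifP => _; rewrite ?block_mx0 // scale_block_mx !scaler0.
Qed.

Lemma mact_idem M g : mact M g 1%g *m mact M g 1%g = mact M g 1%g.
Proof. by rewrite mact1M eqxx. Qed.

Lemma fiber1 M a : fiber M a 1%g = 1%:M.
Proof.
rewrite /fiber -[X in _ *m X *m _]mulmx_base mulmxA.
by rewrite row_col_base ?mact_idem // mul1mx row_col_base ?mact_idem.
Qed.

Lemma mxtrace_fiber M a x : commute a x -> \tr (fiber M a x) = \tr (mact M a x).
Proof.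
move=> ax; rewrite /fiber -mulmxA mxtrace_mulC -mulmxA mulmx_base mactM1.
by rewrite (conjg_commute ax) eqxx.
Qed.

Lemma mxtrace_mact1 M g : \tr (mact M g 1%g) = (\rank (mact M g 1%g))%:R.
Proof. by rewrite -mxtrace_fiber ?fiber1 ?mxtrace1 //; exact: commute1. Qed.

(** An invariant subspace [W] of the fiber at [a] yields the submodule [W'] of vectors whose images
    under all delta_a xbar have coordinates in [W]. By simplicity [W'] is zero or everything, and
    then so is [W]. *)
Lemma fiber_irr M a : simple_mod M -> mact M a 1%g != 0 ->
  irr_twisted_mod w a (fiber M a).
Proof.
move=> [M_gt0 simM] e0; set e := mact M a 1%g in e0 *.
have re := row_col_base (mact_idem M a).
split; first split; first exact: fiber1.
- move=> x y Cx Cy; have ax : (a ^ x = a)%g.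
    by apply/conjg_commute/commute_sym/cent1P.
  rewrite /fiber -/e; move: (row_base e) (col_base e) (mulmx_base e) => r c cr.
  rewrite -!mulmxA (mulmxA c) cr (mulmxA e) mact1M eqxx (mulmxA (mact M a x)).
  by rewrite mactM ax eqxx -scalemxAl -scalemxAr mulmxA.
- by rewrite lt0n mxrank_eq0.
move=> W Winv.
pose f x : 'Hom('cV[k]_(mdim M), 'cV[k]_(\rank e)) := linfun (mulmx (row_base e *m mact M a x)).
pose W' : {vspace 'cV[k]_(mdim M)} := (\bigcap_x (f x @^-1: W))%VS.
have W'P v : reflect (forall x, row_base e *m mact M a x *m v \in W) (v \in W').
  apply: (iffP idP) => [W'v x | W'v].
    have /subvP/(_ v W'v) : (W' <= f x @^-1: W)%VS by exact: (bigcapv_inf x).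
    by rewrite -memv_preim lfunE.
  rewrite memvE; apply/subv_bigcapP=> x _; rewrite -memvE -memv_preim lfunE.
  exact: W'v.
have [|W'0 | W'1] := simM W'.
- move=> g x v /W'P W'v; apply/W'P=> y; rewrite mulmxA -(mulmxA (row_base e)).
  rewrite mactM; case: eqP => _; last by rewrite mulmx0 mul0mx mem0v.
  by rewrite -scalemxAr -scalemxAl memvZ.
- left; apply/eqP; rewrite -subv0; apply/subvP=> v Wv.
  suff W'v : col_base e *m v = 0.
    have := congr1 (mulmx (row_base e)) W'v.
    by rewrite mulmxA re mul1mx mulmx0 => ->; rewrite mem0v.
  apply/eqP; rewrite -memv0 -W'0; apply/W'P=> x.
  have [Cx | Cx] := boolP (x \in 'C[a]%g).
    by rewrite mulmxA; exact: (Winv x).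
  (* If [x] does not centralize [a], then delta_a xbar only sees the component at [a ^ x] and kills
     the one at [a]. *)
  suff e0' : mact M a x *m (col_base e *m v) = 0
    by rewrite -(mulmxA (row_base e)) e0' mulmx0 mem0v.
  have -> : col_base e = e *m col_base e.
    by rewrite -[X in X *m _]mulmx_base -mulmxA re mulmx1.
  rewrite !mulmxA mactM1; case: eqP => [ax|_]; last by rewrite !mul0mx.
  by case/cent1P: Cx; rewrite /commute [RHS]conjgC -ax.
right; apply/eqP; rewrite eqEsubv subvf; apply/subvP=> v _.
have /W'P/(_ 1%g) : col_base e *m v \in W' by rewrite W'1 memvf.
have rE : row_base e *m e = row_base e.
  by rewrite -[X in _ *m X]mulmx_base mulmxA re mul1mx.
by rewrite rE (mulmxA (row_base e)) re mul1mx.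
Qed.

(** Up to the nonzero factor [beta w g x x^-1], delta_g ebar factors through delta_(g ^ x) ebar, so
    the support of a module is a union of conjugacy classes. *)
Lemma mact1_conj M g x : mact M (g ^ x)%g 1%g = 0 -> mact M g 1%g = 0.
Proof.
move=> e0; apply: (scalerI (beta_neq0 w g x x^-1%g)); rewrite scaler0.
have := mactM M g x (g ^ x)%g x^-1%g; rewrite eqxx mulgV => <-.
have := mactM1 M g x (g ^ x)%g; rewrite eqxx e0 mulmx0 => <-.
by rewrite mul0mx.
Qed.

Lemma mact1_neq0 M : (0 < mdim M)%N -> exists g, mact M g 1%g != 0.
Proof.
move=> M_gt0; apply/existsP; apply: contraTT M_gt0 => /existsPn e0.
have one0 : 1%:M = 0 :> 'M[k]_(mdim M).
  by rewrite -mact1 big1 // => g _; apply/eqP; have := e0 g; rewrite negbK.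
by rewrite -leqNgt leqn0 -(mxrank1 k (mdim M)) one0 mxrank0.
Qed.

Lemma S_acts_S (R K H : {set gT}) B M :
    is_transversal R (classes [set: gT]) [set: gT] -> 1%g \in H ->
  S_acts K H B M -> S_subcat w R K H B M.
Proof.
move=> R_repr H1; case/(semisimple char0 (@S_acts_retract K H B))=> n [N [isoM simN]].
exists n, N; split=> // i; have {simN}[simN aN] := simN i.
have [g eg] := mact1_neq0 simN.1.
(* A degree [g] in the support is moved to the representative [a] of its class, which gives the
   label of the simple summand. *)
pose a := transversal_repr 1%g R (g ^: [set: gT])%g.
have Cg : (g ^: [set: gT])%g \in classes [set: gT] by rewrite mem_classes.
have Ra : a \in R by exact: repr_mem_transversal R_repr _ _ Cg.
have [x _ ax] := imsetP (repr_mem_pblock R_repr 1%g Cg : a \in _).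
have ea : mact (N i) a 1%g != 0.
  by apply: contraNneq eg; rewrite ax => /mact1_conj ->.
have Ka : a \in K by apply: contraNT ea => /negPf Ka; rewrite aN // Ka.
exists a, (fun x => \tr (fiber (N i) a x)); split; first by rewrite inE Ka.
- by exists _, (fiber (N i) a); split=> //; exact: fiber_irr.
- by split.
move=> h Hh; rewrite /fiber /= (aN a h Hh) Ka.
by rewrite -scalemxAr -scalemxAl mxtraceZ.
Qed.

End Criterion.

(** * The central idempotent attached to [(K, H, B)] *)

Section Projection.
Variables (gT : finGroupType) (k : fieldType) (w : cocycle3 gT k).
Hypothesis char0 : [pchar k] =i pred0.
Variables (K H : {group gT}) (B : gT -> gT -> k).
Hypotheses (nK : (K <| [set: gT])%g) (nH : (H <| [set: gT])%g)
  (cKH : (K \subset 'C(H))%g).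
Hypothesis B_neq0 : {in K & H, forall x y, B x y != 0}.
Hypothesis B_mulr : forall x y z, x \in K -> y \in H -> z \in H ->
  B x (y * z)%g = (beta w x y z)^-1 * B x y * B x z.
Hypothesis B_inv : G_invariant w K H B.
Implicit Types M N : Dmod w.

Lemma card_group_neq0 : #|H|%:R != 0 :> k.
Proof. by rewrite pchar0_natr_eq0 // -lt0n cardG_gt0. Qed.

Lemma normal_memJ (A : {group gT}) x y : (A <| [set: gT])%g ->
  ((x ^ y)%g \in A) = (x \in A).
Proof. by case/andP=> _ /subsetP nA; rewrite memJ_norm // nA. Qed.

Lemma conj_KH x h : x \in K -> h \in H -> (x ^ h = x)%g.
Proof. by move=> Kx Hh; apply/conjg_commute; exact: commute_cent cKH Kx Hh. Qed.

Lemma bichar_r1 x : x \in K -> B x 1%g = 1.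
Proof.
move=> Kx; have := B_mulr Kx (group1 H) (group1 H).
rewrite mulg1 beta_1x invr1 mul1r -[LHS]mulr1.
by move/(mulfI (B_neq0 Kx (group1 H))).
Qed.

Definition S_proj M : 'M[k]_(mdim M) :=
  #|H|%:R^-1 *: \sum_(g in K) \sum_(t in H) (B g t)^-1 *: mact M g t.

Lemma mact_proj M h y : mact M h y *m S_proj M =
  if h \in K then #|H|%:R^-1 *:
    \sum_(t in H) ((B (h ^ y)%g t)^-1 * beta w h y t) *: mact M h (y * t)%g
  else 0.
Proof.
rewrite /S_proj -scalemxAr mulmx_sumr.
under eq_bigr => g Kg.
  rewrite mulmx_sumr.
  under eq_bigr do rewrite -scalemxAr mactM.
  over.
rewrite -(normal_memJ h y nK); have [Kh | Kh] := ifPn; last first.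
  rewrite big1 ?scaler0 // => g Kg; rewrite big1 // => t Ht.
  case: eqP => [eg|_]; last exact: scaler0.
  by rewrite -eg Kg in Kh.
rewrite (bigD1 (h ^ y)%g) //= [X in _ + X]big1 ?addr0; last first.
  by move=> g /andP[_ /negPf ne]; apply: big1 => t _; rewrite ne scaler0.
by congr (_ *: _); apply: eq_bigr => t _; rewrite eqxx scalerA.
Qed.

Lemma proj_mact M h y : S_proj M *m mact M h y =
  if (h ^ y^-1)%g \in K then #|H|%:R^-1 *:
    \sum_(t in H) ((B h t)^-1 * beta w h t y) *: mact M h (t * y)%g
  else 0.
Proof.
rewrite /S_proj -scalemxAl mulmx_suml (normal_memJ _ _ nK).
have E g : g \in K -> (\sum_(t in H) (B g t)^-1 *: mact M g t) *m mact M h y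
  = if h == g then \sum_(t in H) ((B h t)^-1 * beta w h t y) *: mact M h (t * y)%g else 0.
  move=> Kg; rewrite mulmx_suml; case: eqP => [-> | ne].
    by apply: eq_bigr => t Ht; rewrite -scalemxAl mactM conj_KH // eqxx scalerA.
  rewrite big1 // => t Ht; rewrite -scalemxAl mactM conj_KH //.
  by case: eqP => // _; rewrite scaler0.
rewrite (eq_bigr _ E); have [Kh | Kh] := ifPn.
  rewrite (bigD1 h) //= eqxx [X in _ + X]big1 ?addr0 // => g /andP[_ /negPf ne].
  by rewrite eq_sym ne.
rewrite big1 ?scaler0 // => g Kg; case: eqP => // e.
by rewrite e Kg in Kh.
Qed.

(** The substitution [t -> t ^ y^-1] matches the two sums, and [B_inv] matches their
    coefficients. *)
Lemma proj_hom M : hom M M (S_proj M).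
Proof.
move=> h y; rewrite mact_proj proj_mact (normal_memJ _ _ nK).
case: ifP => // Kh; congr (_ *: _).
rewrite [RHS](reindex_inj (conjg_inj y^-1%g)) /=.
apply: eq_big => [t | t Ht]; first by rewrite (normal_memJ _ _ nH).
have Ht' : (t ^ y^-1)%g \in H by rewrite (normal_memJ _ _ nH).
have tE : (t ^ y^-1 = y * t * y^-1)%g by rewrite conjgE invgK mulgA.
have tyE : (t ^ y^-1 * y = y * t)%g by rewrite tE mulgKV.
rewrite tyE; congr (_ *: _).
have := B_inv y Kh Ht; rewrite -mulgA -conjgE => ->; rewrite -tE.
(* These two cocycle identities remove the factors in [y^-1] introduced by [B_inv]. *)
have := beta_cocycle w h (y * t)%g y^-1%g y; rewrite -tE mulVg beta_x1 mul1r.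
have := beta_cocycle w h y y^-1%g y; rewrite mulVg mulgV beta_x1 beta_1x mul1r mulr1.
rewrite (conjgM h y t) (conj_KH _ Ht) ?(normal_memJ _ _ nK) // => -> e.
by rewrite -e; field; rewrite !beta_neq0 B_neq0.
Qed.

(** Multiplication by [h] translates the average over [H], and [B_mulr] turns the translation into
    the scalar [B g h]. *)
Lemma mact_proj_H M g h : h \in H ->
  mact M g h *m S_proj M = if g \in K then B g h *: (mact M g 1%g *m S_proj M) else 0.
Proof.
move=> Hh; rewrite !mact_proj; case: ifP => // Kg.
rewrite scalerA mulrC -scalerA; congr (_ *: _); rewrite scaler_sumr.
rewrite [RHS](reindex_inj (mulgI h)) /=; apply: eq_big => [t|t Ht].
  by rewrite groupMl.
rewrite conjg1 conj_KH // mul1g beta_1x mulr1 scalerA B_mulr //; congr (_ *: _).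
by field; rewrite !B_neq0 // beta_neq0.
Qed.

(** On the image of [S_proj] each scaled term acts as its delta_g ebar, and these sum to the
    identity there because the components outside [K] are zero. *)
Lemma proj_idem M : S_proj M *m S_proj M = S_proj M.
Proof.
rewrite {1}/S_proj -scalemxAl mulmx_suml.
transitivity (\sum_(g in K) mact M g 1%g *m S_proj M).
  rewrite scaler_sumr; apply: eq_bigr => g Kg; rewrite mulmx_suml.
  rewrite (eq_bigr (fun=> mact M g 1%g *m S_proj M)) => [|t Ht].
    by rewrite sumr_const -scaler_nat scalerA mulVf ?scale1r // card_group_neq0.
  by rewrite -scalemxAl mact_proj_H // Kg scalerA mulVf ?scale1r // B_neq0.
rewrite -mulmx_suml -[RHS]mul1mx -mact1 [in RHS]mulmx_suml.
rewrite [RHS](bigID (mem K)) /= [X in _ = _ + X]big1 ?addr0 ?mulmx_suml //.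
by move=> g /negPf Kg; rewrite mact_proj_H ?group1 // Kg.
Qed.

Lemma S_acts_proj M : S_proj M = 1%:M -> S_acts K H B M.
Proof.
by move=> p1 g h Hh; have := mact_proj_H M g Hh; rewrite p1 !mulmx1 => ->.
Qed.

Lemma S_acts_simple M a chi : simple_obj a chi M -> a \in K ->
  {in H, forall h, chi h = B a h * chi 1%g} -> S_acts K H B M.
Proof.
case=> [[M_gt0 simM]] ea chiE Ka chiB; apply: S_acts_proj.
pose W := limg (linfun (mulmx (S_proj M) : 'cV[k]_(mdim M) -> 'cV[k]_(mdim M))).
have WP v : reflect (exists u, v = S_proj M *m u) (v \in W).
  apply: (iffP memv_imgP) => [[u _ ->] | [u ->]].
    by exists u; rewrite lfunE.
  by exists u; rewrite ?memvf // lfunE.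
have HC h : h \in H -> commute a h by exact: commute_cent cKH Ka.
have trE h : h \in H -> \tr (mact M a h) = B a h * (\rank (mact M a 1%g))%:R.
  move=> Hh; have aC := HC h Hh; rewrite -mxtrace_fiber // chiE; last exact/cent1P.
  by rewrite chiB // -chiE ?group1 // fiber1 mxtrace1.
have [|W0 | W1] := simM W.
- move=> g x v /WP[u ->]; apply/WP; exists (mact M g x *m u).
  by rewrite !mulmxA proj_hom.
(* If the image were zero, the trace of delta_a ebar times the idempotent would vanish; but by [trE]
   each term of the average contributes the dimension of the component at [a]. *)
- case/eqP: ea; apply/eqP; rewrite -mxrank_eq0 -(pchar0_natr_eq0 char0).
  have p0 : S_proj M = 0.
    apply: eq_col_mx => j; rewrite col0 colE; apply/eqP; rewrite -memv0 -W0.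
    by apply/WP; eexists.
  apply/eqP; have := congr1 mxtrace (mact_proj M a 1%g).
  rewrite p0 mulmx0 mxtrace0 Ka mxtraceZ raddf_sum /=.
  rewrite (eq_bigr (fun=> (\rank (mact M a 1%g))%:R)) => [|t Ht].
    by rewrite sumr_const -[X in _ * X]mulr_natl mulKf ?card_group_neq0 // => <-.
  rewrite conjg1 beta_1x mulr1 mul1g mxtraceZ trE // mulrA mulVf ?mul1r //.
  exact: B_neq0.
apply: eq_col_mx => j; rewrite !colE mul1mx.
have /WP[u e] : delta_mx j 0 \in W by rewrite W1 memvf.
by rewrite [X in _ *m X]e mulmxA proj_idem -e.
Qed.

Lemma S_S_acts R M : S_subcat w R K H B M -> S_acts K H B M.
Proof.
case=> n [N [isoM simN]].
apply: S_acts_retract (iso_retract isoM) _.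
elim/big_ind: _ => [|L L' aL aL'|i _]; first exact: S_acts_zero.
  exact: S_acts_dsum.
have [a [chi [/setIP[Ka _] _ simNi chiB]]] := simN i.
exact: S_acts_simple simNi Ka chiB.
Qed.

End Projection.

(** * Tensor products and duals *)

Section TensorMatrices.
Variable k : fieldType.

Lemma tensmxA m1 n1 m2 n2 m3 n3 (A1 : 'M[k]_(m1, n1)) (A2 : 'M_(m2, n2))
    (A3 : 'M_(m3, n3)) :
  A1 *t (A2 *t A3) = castmx (esym (mulnA _ _ _), esym (mulnA _ _ _)) (A1 *t A2 *t A3).
Proof.
have idx a b c (i : 'I_a) (j : 'I_b) (l : 'I_c) :
    cast_ord (mulnA _ _ _) (mxtens_index (i, mxtens_index (j, l)))
    = mxtens_index (mxtens_index (i, j), l).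
  by apply: val_inj; rewrite /= mulnDl mulnA addnA.
apply/matrixP=> i j.
case: (mxtens_indexP i) => i1 i'; case: (mxtens_indexP i') => i2 i3.
case: (mxtens_indexP j) => j1 j'; case: (mxtens_indexP j') => j2 j3.
by rewrite castmxE !esymK !idx !tensmxE mulrA.
Qed.

(** With [tensA_castmx], this moves a triple tensor product past the cast of the associator, so that
    the zigzag identities can be handled factor by factor. *)
Lemma castmx_tensA m1 n1 m2 n2 m3 n3 p (A1 : 'M[k]_(m1, n1)) (A2 : 'M_(m2, n2))
    (A3 : 'M_(m3, n3)) (S : 'M_(p, m1 * m2 * m3)) :
  castmx (erefl, esym (mulnA _ _ _)) S *m (A1 *t (A2 *t A3))
  = castmx (erefl, esym (mulnA _ _ _)) (S *m (A1 *t A2 *t A3)).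
Proof.
rewrite tensmxA mulmx_cast castmx_mul !castmx_comp !castmx_id.
by congr (_ *m _); exact: eq_castmx.
Qed.

Lemma tensA_castmx m1 n1 m2 n2 m3 n3 p (A1 : 'M[k]_(m1, n1)) (A2 : 'M_(m2, n2))
    (A3 : 'M_(m3, n3)) (S : 'M_(n1 * n2 * n3, p)) :
  (A1 *t (A2 *t A3)) *m castmx (esym (mulnA _ _ _), erefl) S
  = castmx (esym (mulnA _ _ _), erefl) ((A1 *t A2 *t A3) *m S).
Proof.
rewrite tensmxA mulmx_cast castmx_mul !castmx_comp !castmx_id.
by congr (_ *m _); exact: eq_castmx.
Qed.

Lemma castmx0 m m' n n' (e : (m = m') * (n = n')) : castmx e (0 : 'M[k]_(m, n)) = 0.
Proof. by apply/matrixP=> i j; rewrite castmxE !mxE. Qed.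

Lemma mxtrace_tens m n (A : 'M[k]_m) (C : 'M[k]_n) : \tr (A *t C) = \tr A * \tr C.
Proof.
rewrite /mxtrace mulr_sum; apply: eq_bigr => i _; by rewrite mxE.
Qed.

Lemma castmx_tens1r m m' n p (e1 : m = m') e2 (A : 'M[k]_(m, n * 1))
    (C : 'M[k]_(n, p)) : castmx (e1, e2) A *m C
  = castmx (e1, muln1 p) (A *m (C *t (1%:M : 'M_1))).
Proof.
rewrite tens_mx_scalar scale1r mulmx_cast castmx_mul !castmx_comp.
rewrite (castmx_id _ C); congr (_ *m _); exact: eq_castmx.
Qed.

Lemma castmx_tens1l m m' n p (e1 : m = m') e2 (A : 'M[k]_(m, 1 * n))
    (C : 'M[k]_(n, p)) : castmx (e1, e2) A *m C
  = castmx (e1, mul1n p) (A *m ((1%:M : 'M_1) *t C)).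
Proof.
rewrite tens_scalar_mx scale1r mulmx_cast castmx_mul !castmx_comp.
rewrite (castmx_id _ C); congr (_ *m _); exact: eq_castmx.
Qed.

Lemma tensmxZr (b : k) m n p q (A : 'M[k]_(m, n)) (C : 'M[k]_(p, q)) :
  A *t (b *: C) = b *: (A *t C).
Proof. by rewrite -[X in X *t _]scale1r tensmxZ mul1r. Qed.

Lemma tensmxZl (b : k) m n p q (A : 'M[k]_(m, n)) (C : 'M[k]_(p, q)) :
  (b *: A) *t C = b *: (A *t C).
Proof. by rewrite -[X in _ *t X]scale1r tensmxZ mulr1. Qed.

Lemma tens_sumr I (r : seq I) (P : pred I) m n p q (A : 'M[k]_(m, n))
    (F : I -> 'M[k]_(p, q)) :
  A *t (\sum_(i <- r | P i) F i) = \sum_(i <- r | P i) A *t F i.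
Proof. exact: (big_morph _ (tensmxDr A) (tensmx0 A)). Qed.

Lemma tens_suml I (r : seq I) (P : pred I) m n p q (F : I -> 'M[k]_(m, n))
    (A : 'M[k]_(p, q)) :
  (\sum_(i <- r | P i) F i) *t A = \sum_(i <- r | P i) F i *t A.
Proof.
by elim/big_rec2: _ => [|i C C' _ <-]; rewrite ?tens0mx ?tensmxDl.
Qed.

End TensorMatrices.

(** * The linear criterion defines a fusion subcategory *)

Section Fusion.
Variables (gT : finGroupType) (k : fieldType) (w : cocycle3 gT k).
Variables (K H : {group gT}) (B : gT -> gT -> k).
Hypothesis (cKH : (K \subset 'C(H))%g).
Hypothesis B_neq0 : {in K & H, forall x y, B x y != 0}.
Hypothesis B_mull : forall u v t, u \in K -> v \in K -> t \in H ->
  B (u * v)%g t = beta w t u v * B u t * B v t.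
Implicit Types M N X Y : Dmod w.

Lemma bichar_l1 t : t \in H -> B 1%g t = 1.
Proof.
move=> Ht; have := B_mull (group1 K) (group1 K) Ht.
rewrite mulg1 beta_1x mul1r -[LHS]mulr1.
by move/(mulfI (B_neq0 (group1 K) Ht)).
Qed.

Lemma S_acts_eq0 M g : S_acts K H B M -> g \notin K -> mact M g 1%g = 0.
Proof. by move=> aM /negPf Kg; rewrite aM ?Kg. Qed.

Lemma S_acts_unit : S_acts K H B (unit_mod w).
Proof.
move=> g h Hh; rewrite /= /unit_act; have [-> | g1] := eqVneq g 1%g.
  by rewrite group1 bichar_l1 // scale1r.
by rewrite raddf0 scaler0 if_same.
Qed.

Lemma S_acts_summand M N : S_acts K H B (dsum M N) -> S_acts K H B M.
Proof.
move=> aMN g h Hh; have := congr1 ulsubmx (aMN g h Hh).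
rewrite /= /dsum_act block_mxKul => ->.
case: ifP => _; last by apply/matrixP=> i j; rewrite !mxE.
by rewrite scale_block_mx block_mxKul.
Qed.

(** On the component [(u, v)], [h] acts by [gamma w h u v * B u h * B v h]. As [h] commutes with
    [K], this is [B (u * v) h] by [B_mull] and can be taken out of the coproduct sum. *)
Lemma S_acts_tens M N : S_acts K H B M -> S_acts K H B N -> S_acts K H B (tens M N).
Proof.
move=> aM aN g h Hh; rewrite /= /tens_act.
transitivity (\sum_(p : gT * gT | (p.1 * p.2)%g == g)
    if g \in K then B g h *: (mact M p.1 1%g *t mact N p.2 1%g) else 0).
  apply: eq_bigr => -[u v] /= /eqP <-; rewrite aM // aN //.
  case: ifPn => Ku; last first.
    by rewrite (S_acts_eq0 aM Ku) !tens0mx !scaler0 if_same.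
  rewrite groupMl //; case: ifPn => Kv; last by rewrite tensmx0 scaler0.
  rewrite tensmxZ scalerA mulrA B_mull //; congr (_ * _ * _ *: _).
  by apply: gamma_commute; apply: commute_sym; exact: commute_cent cKH _ Hh.
case: ifP => Kg; last by rewrite big1.
rewrite -scaler_sumr; congr (_ *: _); apply: eq_bigr => p _.
by rewrite gamma_1 scale1r.
Qed.

(** The failure of [S_acts] in degree [u]. Being homogeneous, it can be passed through the
    associator in the zigzag identities. *)
Definition S_defect M u h : 'M[k]_(mdim M) :=
  mact M u h - (if u \in K then B u h *: mact M u 1%g else 0).

Lemma mact1_defect M g u h :
  mact M g 1%g *m S_defect M u h = if u == g then S_defect M u h else 0.
Proof.
rewrite /S_defect mulmxBr mact1M; case: (u \in K).
  rewrite -scalemxAr mact1M; case: eqP => [->|_] //; by rewrite scaler0 subr0.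
by rewrite mulmx0; case: eqP => [->|]; rewrite ?subr0.
Qed.

Lemma tens_act1_mul M N g u v (A : 'M_(mdim M)) (C : 'M_(mdim N)) :
  tens_act M N g 1%g *m ((mact M u 1%g *m A) *t (mact N v 1%g *m C))
  = if (u * v)%g == g then (mact M u 1%g *m A) *t (mact N v 1%g *m C) else 0.
Proof.
rewrite /tens_act mulmx_suml big_mkcond (bigD1 (u, v)) //= big1 ?addr0.
  by rewrite gamma_1 scale1r tensmx_mul !mulmxA !mact_idem.
case=> u' v'; rewrite xpair_eqE negb_and /= => ne; case: ifP => // _.
rewrite -scalemxAl tensmx_mul !mulmxA !mact1M eq_sym (eq_sym v).
by case/orP: ne => /negPf->; rewrite mul0mx ?tens0mx ?tensmx0 scaler0.
Qed.

Lemma tens_act_mul1 M N g h u v : commute u h -> commute v h ->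
  tens_act M N g h *m (mact M u 1%g *t mact N v 1%g)
  = if (u * v)%g == g then gamma w h u v *: (mact M u h *t mact N v h) else 0.
Proof.
move=> uh vh; rewrite /tens_act mulmx_suml big_mkcond (bigD1 (u, v)) //= big1 ?addr0.
  by rewrite -scalemxAl tensmx_mul !mactM1 !conjg_commute // !eqxx.
case=> u' v'; rewrite xpair_eqE negb_and /= => ne; case: ifP => // _.
rewrite -scalemxAl tensmx_mul !mactM1 -{1}(conjg_commute uh) -{1}(conjg_commute vh).
rewrite !(inj_eq (@conjg_inj _ h)) eq_sym (eq_sym v).
by case/orP: ne => /negPf->; rewrite ?tens0mx ?tensmx0 scaler0.
Qed.

Section Pairing.
Variables M N : Dmod w.
Variable ev : 'M[k]_(1, mdim M * mdim N).
Hypothesis ev_hom : hom (tens M N) (unit_mod w) ev.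

(** The unit object lives in degree [1], and a morphism respects degrees. *)
Lemma pairing_eq0 u v (A : 'M_(mdim M)) (C : 'M_(mdim N)) : (u * v)%g != 1%g ->
  ev *m ((mact M u 1%g *m A) *t (mact N v 1%g *m C)) = 0.
Proof.
move=> uv; have := congr1 (fun Z => Z *m ((mact M u 1%g *m A) *t (mact N v 1%g *m C)))
  (ev_hom (u * v)%g 1%g).
rewrite /= -!mulmxA tens_act1_mul eqxx => <-.
by rewrite /unit_act (negPf uv) raddf0 mul0mx.
Qed.

Lemma pairing_inv u v h : commute u h -> commute v h -> (u * v)%g = 1%g ->
  ev *m (mact M u 1%g *t mact N v 1%g)
  = gamma w h u v *: (ev *m (mact M u h *t mact N v h)).
Proof.
move=> uh vh uv; have := congr1 (fun Z => Z *m (mact M u 1%g *t mact N v 1%g))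
  (ev_hom 1%g h).
rewrite /= -!mulmxA tens_act_mul1 // uv eqxx /unit_act eqxx mul1mx => ->.
by rewrite -scalemxAr.
Qed.

(** In the only relevant case, [u * v = 1] with [v] in [K], [h] acts on the second factor by
    [B v h]. Seen through the invariant pairing, it must act on the first by the inverse of
    [gamma w h u v * B v h], which is [B u h] by [B_mull]. *)
Lemma pairing_defectl u h : S_acts K H B N -> h \in H ->
  ev *m (S_defect M u h *t 1%:M) = 0.
Proof.
move=> aN Hh; have QE : S_defect M u h = mact M u 1%g *m S_defect M u h.
  by rewrite mact1_defect eqxx.
rewrite -mact1 tens_sumr mulmx_sumr big1 // => v _.
have [uv | uv] := eqVneq (u * v)%g 1%g; last first.
  by rewrite QE -[mact N v 1%g]mulmx1 pairing_eq0.
have [Kv | Kv] := boolP (v \in K); last first.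
  by rewrite (S_acts_eq0 aN Kv) tensmx0 mulmx0.
have Ku : u \in K by rewrite -(groupMr _ Kv) uv group1.
have uh : commute u h by exact: commute_cent cKH Ku Hh.
have vh : commute v h by exact: commute_cent cKH Kv Hh.
have := pairing_inv uh vh uv; rewrite (aN v h Hh) Kv => e.
have := B_mull Ku Kv Hh; rewrite uv bichar_l1 // -gamma_commute; try exact: commute_sym.
rewrite /S_defect Ku -scaleN1r => B1.
rewrite tensmxDl mulmxDr !tensmxZl -!scalemxAr e tensmxZr -scalemxAr !scalerA.
have -> : -1 * B u h * gamma w h u v * B v h = - (gamma w h u v * B u h * B v h).
  by ring.
by rewrite -B1 scaleN1r subrr.
Qed.
Lemma pairing_defectr v h : S_acts K H B M -> h \in H ->
  ev *m (1%:M *t S_defect N v h) = 0.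
Proof.
move=> aM Hh; have QE : S_defect N v h = mact N v 1%g *m S_defect N v h.
  by rewrite mact1_defect eqxx.
rewrite -mact1 tens_suml mulmx_sumr big1 // => u _.
have [uv | uv] := eqVneq (u * v)%g 1%g; last first.
  by rewrite QE -[mact M u 1%g]mulmx1 pairing_eq0.
have [Ku | Ku] := boolP (u \in K); last first.
  by rewrite (S_acts_eq0 aM Ku) tens0mx mulmx0.
have Kv : v \in K by rewrite -(groupMl _ Ku) uv group1.
have uh : commute u h by exact: commute_cent cKH Ku Hh.
have vh : commute v h by exact: commute_cent cKH Kv Hh.
have := pairing_inv uh vh uv; rewrite (aM u h Hh) Ku => e.
have := B_mull Ku Kv Hh; rewrite uv bichar_l1 // -gamma_commute; try exact: commute_sym.
rewrite /S_defect Kv -scaleN1r => B1.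
rewrite tensmxDr mulmxDr !tensmxZr -!scalemxAr e tensmxZl -scalemxAr !scalerA.
have -> : -1 * B v h * gamma w h u v * B u h = - (gamma w h u v * B u h * B v h).
  by ring.
by rewrite -B1 scaleN1r subrr.
Qed.

End Pairing.

Lemma mact_eq_defect M : (forall u h, h \in H -> S_defect M u h = 0) -> S_acts K H B M.
Proof. by move=> d0 g h Hh; apply/eqP; rewrite -subr_eq0; apply/eqP; exact: d0. Qed.

(* If Q kills the pairing, the zigzag identity exhibits the identity of Y as a
   map factoring through the pairing, hence Q = 0; the associator is harmless
   since Q is supported on a single homogeneous component. *)
Lemma S_acts_left_dual X Y : left_dual Y X -> S_acts K H B X -> S_acts K H B Y.
Proof.
case=> ev [coev [ev_hom _ _ zz]] aX; apply: mact_eq_defect => u h Hh.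
set Q := S_defect Y u h.
have evQ : ev *m (Q *t 1%:M) = 0 by exact: pairing_defectl.
have QE g : mact Y g 1%g *m Q = if u == g then Q else 0 by exact: mact1_defect.
rewrite -[Q]mul1mx -zz castmx_tens1r -!mulmxA tensmx_mul mul1mx mulmx1.
have -> : Q *t coev = (Q *t (1%:M *t 1%:M)) *m (1%:M *t coev).
  by rewrite tensmx11 tensmx_mul mul1mx mulmx1.
rewrite (mulmxA (assoc_inv_mx _ _ _)) /assoc_inv_mx castmx_tensA.
have -> : (\sum_g \sum_h \sum_l w g h l *:
     (mact Y g 1%g *t mact X h 1%g *t mact Y l 1%g)) *m (Q *t 1%:M *t 1%:M)
  = (Q *t 1%:M *t 1%:M) *m
    \sum_h \sum_l w u h l *: (1%:M *t mact X h 1%g *t mact Y l 1%g).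
  rewrite mulmx_suml (bigD1 u) //= [X in _ + X]big1 ?addr0 => [|g /negPf ug].
    rewrite mulmx_suml mulmx_sumr; apply: eq_bigr => h' _.
    rewrite mulmx_suml mulmx_sumr; apply: eq_bigr => l _.
    rewrite -scalemxAl -scalemxAr !tensmx_mul QE eqxx mulmx1 mul1mx.
    by rewrite !(mulmx1, mul1mx).
  rewrite mulmx_suml big1 // => h' _; rewrite mulmx_suml big1 // => l _.
  by rewrite -scalemxAl !tensmx_mul QE eq_sym ug !tens0mx scaler0.
rewrite mulmxA [X in X *m _](_ : _ = 0) ?mul0mx ?castmx0 //.
rewrite -[X in X *m _](castmx_id (erefl, erefl)) -castmx_mul mulmxA tensmx_mul evQ.
by rewrite tens0mx mul0mx castmx0.
Qed.

(** Mirror image of [S_acts_left_dual]: the other zigzag identity is used, with [Q] in the last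
    tensor factor. *)
Lemma S_acts_right_dual X Y : left_dual X Y -> S_acts K H B X -> S_acts K H B Y.
Proof.
case=> ev [coev [ev_hom _ zz _]] aX; apply: mact_eq_defect => v h Hh.
set Q := S_defect Y v h.
have evQ : ev *m (1%:M *t Q) = 0 by exact: pairing_defectr.
have QE g : mact Y g 1%g *m Q = if v == g then Q else 0 by exact: mact1_defect.
rewrite -[Q]mul1mx -zz castmx_tens1l -!mulmxA tensmx_mul mul1mx mulmx1.
have -> : coev *t Q = (1%:M *t 1%:M *t Q) *m (coev *t 1%:M).
  by rewrite tensmx11 tensmx_mul mul1mx mulmx1.
rewrite (mulmxA (assoc_mx _ _ _)) /assoc_mx.
rewrite -[X in _ *m (_ *m X *m _)](castmx_id (erefl, erefl)) -castmx_mul.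
have -> : (\sum_g \sum_h \sum_l (w g h l)^-1 *:
     (mact Y g 1%g *t mact X h 1%g *t mact Y l 1%g)) *m (1%:M *t 1%:M *t Q)
  = (1%:M *t 1%:M *t Q) *m
    \sum_g \sum_h (w g h v)^-1 *: (mact Y g 1%g *t mact X h 1%g *t 1%:M).
  rewrite mulmx_suml mulmx_sumr; apply: eq_bigr => g _.
  rewrite mulmx_suml mulmx_sumr; apply: eq_bigr => h' _.
  rewrite mulmx_suml (bigD1 v) //= [X in _ + X]big1 ?addr0 => [|l /negPf vl].
    rewrite -scalemxAl -scalemxAr !tensmx_mul QE eqxx.
    by rewrite !(mulmx1, mul1mx).
  by rewrite -scalemxAl !tensmx_mul QE eq_sym vl !tensmx0 scaler0.
rewrite -tensA_castmx !mulmxA tensmx_mul evQ.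
by rewrite tensmx0 !mul0mx castmx0.
Qed.

Lemma S_acts_iso M N : iso M N -> S_acts K H B M -> S_acts K H B N.
Proof. by move=> isoMN; apply: S_acts_retract; apply/iso_retract/iso_sym. Qed.

Lemma S_acts_fusion : fusion_subcat (S_acts K H B : subcat w).
Proof.
split; [exact: S_acts_iso | exact: S_acts_unit | exact: S_acts_dsum
  | exact: S_acts_summand | exact: S_acts_tens | exact: S_acts_left_dual
  | exact: S_acts_right_dual].
Qed.

End Fusion.

(** * The regular module *)

Section Regular.
Variables (gT : finGroupType) (k : fieldType) (w : cocycle3 gT k).

Let T := (gT * gT)%type.

(** The basis vector indexed by [(h, y)] stands for delta_h ybar, and the action is left
    multiplication. *)
Definition reg_act (g x : gT) : 'M[k]_#|{: T}| := \matrix_(i, j)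
  let p := enum_val j in
  if (p.1 == (g ^ x)%g) && (enum_val i == (g, (x * p.2)%g)) then beta w g x p.2 else 0.

Lemma reg_actM g x h y : reg_act g x *m reg_act h y
  = if h == (g ^ x)%g then beta w g x y *: reg_act g (x * y)%g else 0.
Proof.
apply/matrixP=> i j; rewrite mxE.
under eq_bigr do rewrite !mxE.
set p := enum_val i; set q := enum_val j.
rewrite (reindex (@enum_rank T)) /=; last first.
  by exists enum_val => ? _; rewrite ?enum_rankK ?enum_valK.
under eq_bigr do rewrite enum_rankK.
rewrite (bigD1 (h, (y * q.2)%g)) //= big1 ?addr0; last first.
  by move=> r /negPf->; rewrite andbF mulr0.
rewrite eqxx andbT; have [-> | ne] := eqVneq h _; last by rewrite mul0r !mxE.
rewrite !mxE -/p -/q conjgM !mulgA /=.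
case: (q.1 == _); rewrite /= ?mulr0 //; case: (p == _); rewrite ?mul0r ?mulr0 //.
by rewrite -beta_cocycle.
Qed.

Lemma reg_act1 : \sum_g reg_act g 1%g = 1%:M.
Proof.
apply/matrixP=> i j; rewrite summxE.
under eq_bigr do rewrite mxE /= conjg1 mul1g beta_1x.
rewrite (bigD1 (enum_val j).1) //= eqxx big1 ?addr0 => [|g /negPf gj].
  by rewrite -surjective_pairing (inj_eq enum_val_inj) mxE; case: eqP.
by rewrite eq_sym gj.
Qed.

Definition reg_mod : Dmod w := DMod reg_actM reg_act1.

(** A nonzero diagonal entry at [(h, y)] needs [x * y = y]; for [x = 1] the vectors with [h = g]
    contribute [1] each. *)
Lemma mxtrace_reg g x :
  \tr (mact reg_mod g x) = if x == 1%g then #|gT|%:R else 0.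
Proof.
rewrite /mxtrace (reindex (@enum_rank T)) /=; last first.
  by exists enum_val => ? _; rewrite ?enum_rankK ?enum_valK.
under eq_bigr do rewrite mxE /= enum_rankK.
have [-> | x1] := eqVneq x 1%g; last first.
  rewrite big1 // => -[u v] _ /=; rewrite xpair_eqE.
  case: (v =P (x * v)%g) => [/(congr1 (fun z => z * v^-1)%g)|]; last by rewrite !andbF.
  by rewrite mulgK mulgV => e; rewrite -e eqxx in x1.
under eq_bigr => p _.
  rewrite conjg1 mul1g beta_1x.
  have -> : (p.1 == g) && (p == (g, p.2)) = (p.1 == g).
    by case: p => u v /=; rewrite xpair_eqE eqxx andbT andbb.
  over.
rewrite -(pair_bigA _ (fun u v => if u == g then 1 else 0 : k)) /= (bigD1 g) //=.
rewrite eqxx sumr_const [X in _ + X]big1 ?addr0 // => u /negPf->.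
by rewrite big1.
Qed.

End Regular.

(** * The image of the idempotent on the regular module *)

Section Universal.
Variables (gT : finGroupType) (k : fieldType) (w : cocycle3 gT k).
Hypothesis char0 : [pchar k] =i pred0.
Variables (K H : {group gT}) (B : gT -> gT -> k).
Hypotheses (nK : (K <| [set: gT])%g) (nH : (H <| [set: gT])%g)
  (cKH : (K \subset 'C(H))%g).
Hypothesis bicharB : bicharacter w K H B.
Hypothesis B_inv : G_invariant w K H B.

(** The trace on the image is the trace against [S_proj] on the regular module, where only
    [t = x^-1] contributes; hence [c = #|gT| / #|H|]. Multiplicativity of [B] turns the inverse of
    [B g x^-1] into [B g x]. *)
Lemma universal_mod : exists X : Dmod w, S_acts K H B X /\
  exists2 c : k, c != 0 & forall g x, \tr (mact X g x) =
    if (g \in K) && (x \in H) then c * B g x else 0.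
Proof.
have [B0 Br _] := bicharB.
have ph := proj_hom nK nH cKH B0 B_inv (reg_mod w).
have pp := proj_idem char0 nK cKH B0 Br (reg_mod w).
have [X [s [r [hs hr rs sr]]]] := image_dmod ph pp.
have XE g x : mact X g x = r *m mact (reg_mod w) g x *m s.
  by rewrite -mulmxA hs mulmxA rs mul1mx.
exists X; split.
  have ps : S_proj K H B (reg_mod w) *m s = s by rewrite -sr -mulmxA rs mulmx1.
  move=> g h Hh; rewrite !XE -ps -!mulmxA (mulmxA (mact _ g h)).
  rewrite (mact_proj_H nK cKH B0 Br _ _ Hh); case: ifP => _.
    by rewrite -scalemxAl -scalemxAr !mulmxA.
  by rewrite mul0mx mulmx0.
exists (#|H|%:R^-1 * #|gT|%:R) => [|g x].
  by rewrite mulf_neq0 ?invr_eq0 ?card_neq0 ?card_group_neq0.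
rewrite XE mxtrace_mulC mulmxA sr mxtrace_mulC mact_proj //.
have [Kg | _] := ifP; last by rewrite mxtrace0.
rewrite mxtraceZ raddf_sum /=.
under eq_bigr do rewrite mxtraceZ mxtrace_reg.
have [Hx | Hx] := boolP (x \in H); last first.
  rewrite big1 ?mulr0 // => t Ht; case: eqP => [xt1|]; rewrite ?mulr0 //.
  by rewrite -(groupMr _ Ht) xt1 group1 in Hx.
rewrite (bigD1 x^-1%g) ?groupV //= mulgV eqxx big1 ?addr0; last first.
  by move=> t /andP[_ /negPf tx]; rewrite -eq_invg_mul eq_sym tx mulr0.
have Hx' : x^-1%g \in H by rewrite groupV.
have := Br g x x^-1%g Kg Hx Hx'; rewrite mulgV (bichar_r1 B0 Br Kg) (conj_KH cKH Kg Hx).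
move=> B1; have -> : B g x = beta w g x x^-1%g * (B g x^-1%g)^-1 *
   ((beta w g x x^-1%g)^-1 * B g x * B g x^-1%g).
  by field; rewrite beta_neq0 B0.
by rewrite -B1; ring.
Qed.

Lemma S_actsE (R : {set gT}) : is_transversal R (classes [set: gT]) [set: gT] ->
  forall M, S_subcat w R K H B M <-> S_acts K H B M.
Proof.
move=> R_repr M; have [B0 Br _] := bicharB; split; first exact: S_S_acts.
exact: S_acts_S.
Qed.

End Universal.

(** * Intersection *)

Section Meet.
Variables (gT : finGroupType) (k : fieldType) (w : cocycle3 gT k).
Hypothesis char0 : [pchar k] =i pred0.
Variables (R : {set gT}) (K H K' H' : {group gT}) (B B' : gT -> gT -> k).
Hypothesis R_repr : is_transversal R (classes [set: gT]) [set: gT].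
Hypotheses (nK : (K <| [set: gT])%g) (nH : (H <| [set: gT])%g)
  (nK' : (K' <| [set: gT])%g) (nH' : (H' <| [set: gT])%g).
Hypotheses (cKH : (K \subset 'C(H))%g) (cKH' : (K' \subset 'C(H'))%g).
Hypotheses (bicharB : bicharacter w K H B) (invB : G_invariant w K H B).
Hypotheses (bicharB' : bicharacter w K' H' B') (invB' : G_invariant w K' H' B').
Implicit Types M N X Y Z : Dmod w.

Local Notation ker := (ker_phi K H B K' H' B').

Lemma ker_phiP a : reflect
  [/\ a \in K, a \in K' & forall t, t \in H -> t \in H' -> B a t = B' a t]
  (a \in ker).
Proof.
have [[B0 _ _] [B0' _ _]] := (bicharB, bicharB').
rewrite !inE; apply: (iffP andP) => [[/andP[Ka Ka'] /forall_inP phi1] | [Ka Ka' e]].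
  split=> // t Ht Ht'; have /eqP e : phi B B' a t == 1 by rewrite phi1 // inE Ht.
  by rewrite -[LHS](mulfVK (B0' a t Ka' Ht')) [X in X * _]e mul1r.
rewrite Ka Ka'; split=> //; apply/forall_inP => t /setIP[Ht Ht'].
by rewrite /phi e // divff // B0'.
Qed.

Local Notation psi_meet := (psi w H B H' B').

Lemma psi_meetE a h h' : a \in ker -> h \in H -> h' \in H' ->
  psi_meet a (h * h')%g = (beta w a h h')^-1 * B a h * B' a h'.
Proof. by apply: psiE bicharB bicharB'; rewrite centsC. Qed.

Lemma mact_mul_eq0 M g x : mact M g 1%g = 0 -> mact M g x = 0.
Proof. by move=> e0; have := mact1M M g g x; rewrite eqxx e0 mul0mx. Qed.

Lemma S_acts_meet M : S_acts K H B M -> S_acts K' H' B' M ->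
  S_acts ker (H * H')%g psi_meet M.
Proof.
move=> aM aM' g y /mulsgP[h h' Hh Hh' ->]; have [Kg | nKg] := ifPn.
  have [Kg1 Kg' _] := ker_phiP _ Kg.
  have := mactM M g h g h'; rewrite (conj_KH cKH Kg1 Hh) eqxx (aM g h Hh) (aM' g h' Hh') Kg1 Kg'.
  rewrite -scalemxAl -scalemxAr mact_idem scalerA psi_meetE // => e.
  apply: (scalerI (beta_neq0 w g h h')); rewrite -e scalerA; congr (_ *: _).
  by field; exact: beta_neq0.
(* On a nonzero component the scalars [B g t] and [B' g t] give the same operator, hence agree,
   which forces [g] into the kernel. *)
apply: mact_mul_eq0; apply/eqP; apply: contraNT nKg => eg.
have Kg : g \in K by apply: contraNT eg => Kg; rewrite (S_acts_eq0 aM Kg).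
have Kg' : g \in K' by apply: contraNT eg => Kg'; rewrite (S_acts_eq0 aM' Kg').
apply/ker_phiP; split=> // t Ht Ht'.
have := aM g t Ht; rewrite (aM' g t Ht') Kg Kg' => /eqP.
rewrite -subr_eq0 -scalerBl scaler_eq0 (negPf eg) orbF subr_eq0.
by move/eqP.
Qed.

(** The inclusion into the right-hand side goes through [S_acts]. Conversely the same simple
    summands serve, since [psi_meet] restricts to [B] on [H] and to [B'] on [H']. *)
Lemma S_meet M : S_subcat w R K H B M /\ S_subcat w R K' H' B' M <->
  S_subcat w R ker (H * H')%g psi_meet M.
Proof.
have [[B0 Br _] [B0' Br' _]] := (bicharB, bicharB').
have SE := S_actsE char0 nK nH cKH bicharB invB R_repr.
have SE' := S_actsE char0 nK' nH' cKH' bicharB' invB' R_repr.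
split=> [[/SE aM /SE' aM'] | [n [N [isoM simN]]]].
  apply: S_acts_S => //; first by rewrite -[1%g]mulg1 mem_mulg.
  exact: S_acts_meet.
split; exists n, N; split=> // i; have [a [chi [/setIP[ka Ra] irr sim chiB]]] := simN i.
  have [Ka Ka' _] := ker_phiP _ ka; exists a, chi; split=> //; first exact/setIP.
  move=> h Hh; rewrite -(mulg1 h) chiB ?mem_mulg // psi_meetE // beta_x1 mulg1.
  by rewrite (bichar_r1 B0' Br') // invr1 mul1r mulr1.
have [Ka Ka' _] := ker_phiP _ ka; exists a, chi; split=> //; first exact/setIP.
move=> h Hh; rewrite -(mul1g h) chiB ?mem_mulg // psi_meetE // beta_1x mul1g.
by rewrite (bichar_r1 B0 Br) // invr1 !mul1r.
Qed.

End Meet.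

(** * Join *)

Section JoinBicharacter.
Variables (gT : finGroupType) (k : fieldType) (w : cocycle3 gT k).

Lemma beta_swap t u v : commute t u -> commute t v ->
  beta w v u t * beta w t u (v ^ u)%g = beta w v t u * beta w t v u.
Proof.
move=> tu tv; have tvu : commute t (v ^ u)%g.
  by rewrite conjgE; apply: commuteM; [exact: commuteV | exact: commuteM].
have vt := conjg_commute (commute_sym tv).
rewrite /beta -(tu : _ = _ :> gT) !(conjgM v t) !(conjgM t) vt.
rewrite !(conjg_commute tu) !(conjg_commute tv) !(conjg_commute tu) (conjg_commute tvu).
by field; rewrite !cocycle_neq0.
Qed.

End JoinBicharacter.

(** * Detecting retracts by traces *)

Section Hom.
Variables (gT : finGroupType) (k : fieldType) (w : cocycle3 gT k).
Hypothesis char0 : [pchar k] =i pred0.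
Implicit Types M N : Dmod w.

(* The sum is the trace of the averaging operator, up to the factor #|gT|. *)
Lemma average_neq0 M N :
  \sum_g \sum_x (beta w g x x^-1%g)^-1 *
     (\tr (mact N g x) * \tr (mact M (g ^ x)%g x^-1%g)) != 0 ->
  exists p : 'M_(mdim N, mdim M), average p != 0.
Proof.
move=> tr_neq0; apply: NNPP => no_p; case/eqP: tr_neq0.
pose avg := @average _ _ _ M N; have avg0 p : avg p = 0.
  by apply/eqP; apply: NNPP => /negP e; apply: no_p; exists p.
transitivity (#|gT|%:R * \sum_i \sum_j avg (delta_mx i j) i j); last first.
  by rewrite big1 ?mulr0 // => i _; rewrite big1 // => j _; rewrite avg0 mxE.
have avgE i j : avg (delta_mx i j) i j = #|gT|%:R^-1 *
    \sum_g \sum_x (beta w g x x^-1%g)^-1 * (mact N g x i i * mact M (g ^ x)%g x^-1%g j j).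
  rewrite mxE; congr (_ * _); rewrite summxE; apply: eq_bigr => g _.
  rewrite summxE; apply: eq_bigr => x _; rewrite mxE; congr (_ * _).
  rewrite mxE (bigD1 j) //= big1 ?addr0 => [|l /negPf lj].
    rewrite mxE (bigD1 i) //= big1 ?addr0 => [|l /negPf li].
      by rewrite !mxE !eqxx mulr1.
    by rewrite !mxE li mulr0.
  rewrite mxE big1 ?mul0r // => i' _; by rewrite !mxE lj andbF mulr0.
under [in RHS]eq_bigr => i _ do under eq_bigr => j _ do rewrite avgE.
under [in RHS]eq_bigr => i _ do rewrite -mulr_sumr.
rewrite -mulr_sumr mulVKf ?card_neq0 //.
under [RHS]eq_bigr => i _ do rewrite exchange_big.
rewrite [RHS]exchange_big; apply: eq_bigr => g _ /=.
under [RHS]eq_bigr => i _ do rewrite exchange_big.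
rewrite [RHS]exchange_big; apply: eq_bigr => x _ /=.
rewrite /mxtrace mulr_suml mulr_sumr; apply: eq_bigr => i _.
by rewrite !mulr_sumr.
Qed.

(** A nonzero average is a morphism whose kernel is a proper submodule of a simple module, so it is
    injective and splits. *)
Lemma simple_retract_trace M N : simple_mod M ->
  \sum_g \sum_x (beta w g x x^-1%g)^-1 *
     (\tr (mact N g x) * \tr (mact M (g ^ x)%g x^-1%g)) != 0 ->
  retract M N.
Proof.
move=> [_ simM] /average_neq0[p p0]; have hs := average_hom p.
set s := average p in p0 hs.
apply: (maschke_mono char0 hs) => v sv0.
pose W := lker (linfun (mulmx s : 'cV[k]_(mdim M) -> 'cV[k]_(mdim N))).
have WP u : (u \in W) = (s *m u == 0) by rewrite memv_ker lfunE.
have [|W0 | W1] := simM W.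
- move=> g x u; rewrite !WP mulmxA -hs -mulmxA => /eqP->.
  by rewrite mulmx0.
- by apply/eqP; rewrite -memv0 -W0 WP sv0.
case/eqP: p0; apply: eq_col_mx => j; rewrite col0 colE; apply/eqP.
by rewrite -WP W1 memvf.
Qed.

End Hom.

(* The cocycle bookkeeping of psi_join_mull: the x, y and p, ..., v are values of
   beta w t, e1, ..., e4 are instances of beta_cocycle, and e5 is
   bichar_conj_swap. *)
Lemma twisted_rearrange (k : comNzRingType)
    (x1 x2 x3 y1 y2 y3 p q r s u v b b' a d f : k) :
    x2 * x1 = p * q -> r * s = q * x3 -> u * s = v * y3 -> y2 * y1 = p * v ->
    r * b' = u * b ->
  x1 * (x2 * a * d) * (x3 * b' * f) = y1 * (y2 * a * b) * (y3 * d * f).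
Proof.
move=> e1 e2 e3 e4 e5.
transitivity (x2 * x1 * x3 * b' * (a * d * f)); first by ring.
transitivity (q * x3 * p * b' * (a * d * f)); first by rewrite e1; ring.
transitivity (r * b' * s * p * (a * d * f)); first by rewrite -e2; ring.
transitivity (u * s * p * b * (a * d * f)); first by rewrite e5; ring.
transitivity (p * v * y3 * b * (a * d * f)); first by rewrite e3; ring.
by rewrite -e4; ring.
Qed.

Section Join.
Variables (gT : finGroupType) (k : fieldType) (w : cocycle3 gT k).
Hypothesis char0 : [pchar k] =i pred0.
Variables (R : {set gT}) (K H K' H' : {group gT}) (B B' : gT -> gT -> k).
Hypothesis R_repr : is_transversal R (classes [set: gT]) [set: gT].
Hypotheses (nK : (K <| [set: gT])%g) (nH : (H <| [set: gT])%g)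
  (nK' : (K' <| [set: gT])%g) (nH' : (H' <| [set: gT])%g).
Hypotheses (cKH : (K \subset 'C(H))%g) (cKH' : (K' \subset 'C(H'))%g).
Hypotheses (bicharB : bicharacter w K H B) (invB : G_invariant w K H B).
Hypotheses (bicharB' : bicharacter w K' H' B') (invB' : G_invariant w K' H' B').
Implicit Types M N X Y Z : Dmod w.

Let B0 : {in K & H, forall x y, B x y != 0}. Proof. by case: bicharB. Qed.
Let B0' : {in K' & H', forall x y, B' x y != 0}. Proof. by case: bicharB'. Qed.
Let Br x y z : x \in K -> y \in H -> z \in H ->
  B x (y * z)%g = (beta w x y z)^-1 * B x y * B x z.
Proof. by case: bicharB => _ + _; apply. Qed.
Let Br' x y z : x \in K' -> y \in H' -> z \in H' ->
  B' x (y * z)%g = (beta w x y z)^-1 * B' x y * B' x z.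
Proof. by case: bicharB' => _ + _; apply. Qed.
Let Bl u v t : u \in K -> v \in K -> t \in H ->
  B (u * v)%g t = beta w t u v * B u t * B v t.
Proof. by case: bicharB => _ _; apply. Qed.
Let Bl' u v t : u \in K' -> v \in K' -> t \in H' ->
  B' (u * v)%g t = beta w t u v * B' u t * B' v t.
Proof. by case: bicharB' => _ _; apply. Qed.

Local Notation ker := (ker_phi H K (opf B) H' K' (opf B')).
Local Notation psi_join := (opf (psi (inv_cocycle w) K (opf B) K' (opf B'))).

Lemma ker_opP t : reflect
  [/\ t \in H, t \in H' & forall z, z \in K -> z \in K' -> B z t = B' z t]
  (t \in ker).
Proof. exact: (ker_phiP (bicharacter_op bicharB) (bicharacter_op bicharB')). Qed.

Lemma psi_joinE u v t : u \in K -> v \in K' -> t \in ker ->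
  psi_join (u * v)%g t = beta w t u v * B u t * B' v t.
Proof.
move=> Ku Kv Dt; rewrite /opf.
rewrite (psiE cKH (bicharacter_op bicharB) (bicharacter_op bicharB') Dt Ku Kv).
by rewrite beta_inv invrK.
Qed.

Lemma ker_op_group_set : group_set ker.
Proof.
apply/group_setP; split.
  apply/ker_opP; split=> // z Kz Kz'.
  by rewrite (bichar_r1 B0 Br Kz) (bichar_r1 B0' Br' Kz').
move=> s t /ker_opP[Hs Hs' es] /ker_opP[Ht Ht' et].
apply/ker_opP; split; rewrite ?groupM // => z Kz Kz'.
by rewrite Br // Br' // es // et.
Qed.

Let D := Group ker_op_group_set.

(** The invariance formulas for [B] and [B'] carry the same factor in [beta], which cancels, so
    conjugation transports the equality defining the kernel. *)
Lemma ker_op_normal : (D <| [set: gT])%g.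
Proof.
apply/andP; split; first exact: subsetT.
apply/subsetP=> x _; rewrite inE; apply/subsetP=> _ /imsetP[t Dt ->].
have [Ht Ht' e] := ker_opP _ Dt; apply/ker_opP.
split; rewrite ?normal_memJ // => z Kz Kz'.
have Kc : (z ^ x^-1)%g \in K by rewrite normal_memJ.
have Kc' : (z ^ x^-1)%g \in K' by rewrite normal_memJ.
have zE : (z ^ x^-1 = x * (z * x^-1))%g by rewrite conjgE invgK.
have := invB x^-1%g Kz Ht; have := invB' x^-1%g Kz' Ht'.
rewrite invgK -!mulgA -conjgE -zE e // => ->; move/mulfI => -> //.
apply: mulf_neq0; first apply: mulf_neq0; rewrite ?invr_eq0; exact: beta_neq0.
Qed.

Lemma ker_op_cent x t : x \in (K <*> K')%g -> t \in ker -> commute t x.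
Proof.
move=> Kx Dt.
have DH : D \subset H by apply/subsetP=> s /ker_opP[].
have DH' : D \subset H' by apply/subsetP=> s /ker_opP[].
have cKD : (K <*> K' \subset 'C(D))%g.
  by rewrite join_subG (subset_trans cKH (centS DH)) (subset_trans cKH' (centS DH')).
exact/commute_sym/(commute_cent cKD).
Qed.

Lemma joinKK : (K <*> K')%g = (K * K')%g.
Proof. by apply: norm_joinEl; apply: subset_trans (subsetT _) (normal_norm nK'). Qed.

Lemma joinKKP x : x \in (K <*> K')%g ->
  exists u v, [/\ u \in K, v \in K' & x = (u * v)%g].
Proof. by rewrite joinKK => /mulsgP[u v Ku Kv ->]; exists u, v. Qed.

Lemma mem_joinKK u v : u \in K -> v \in K' -> (u * v)%g \in (K <*> K')%g.
Proof. by move=> Ku Kv; rewrite joinKK mem_mulg. Qed.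

Lemma psi_join_neq0 : {in (K <*> K')%g & D, forall x t, psi_join x t != 0}.
Proof.
move=> x t /joinKKP[u [v [Ku Kv ->]]] Dt; have [Ht Ht' _] := ker_opP _ Dt.
rewrite psi_joinE //; apply: mulf_neq0; last exact: B0'.
by apply: mulf_neq0; [exact: beta_neq0 | exact: B0].
Qed.

(** Up to the factor [B u t], the two sides are the values that twisted multiplicativity assigns to
    the factorizations [u * v ^ u] and [v * u] of one element. They agree by G-invariance of [B']
    and [beta_swap]. *)
Lemma bichar_conj_swap u v t : u \in K -> v \in K' -> t \in ker ->
  beta w t u (v ^ u)%g * B' (v ^ u)%g t = beta w t v u * B' v t.
Proof.
move=> Ku Kv Dt; have [Ht Ht' _] := ker_opP _ Dt.
have tu : commute t u by apply: ker_op_cent Dt; rewrite -[u]mulg1 mem_joinKK.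
have tv : commute t v by apply: ker_op_cent Dt; rewrite -[v]mul1g mem_joinKK.
have := invB' u Kv Ht'; rewrite -mulgA -conjgE -(tu : _ = _ :> gT) mulgK.
have := beta_cocycle w v t u u^-1%g.
rewrite (conjg_commute (commute_sym tv)) mulgV beta_x1 mul1r => <-.
move=> ->; have := beta_swap w tu tv => e.
transitivity (beta w v u t * beta w t u (v ^ u)%g / beta w v t u * B' v t).
  by field; rewrite !beta_neq0.
by rewrite e; field; rewrite beta_neq0.
Qed.

Lemma psi_join_mull x y t : x \in (K <*> K')%g -> y \in (K <*> K')%g -> t \in D ->
  psi_join (x * y)%g t = beta w t x y * psi_join x t * psi_join y t.
Proof.
move=> /joinKKP[a [b [Ka Kb ->]]] /joinKKP[d [f [Kd Kf ->]]] Dt.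
have [Ht Ht' _] := ker_opP _ Dt.
have Kbd : (b ^ d)%g \in K' by rewrite normal_memJ.
have bd : (d * b ^ d = b * d)%g by rewrite -conjgC.
have bdf : (d * (b ^ d * f) = b * (d * f))%g by rewrite (mulgA d) bd -mulgA.
(* Normality of [K'] allows regrouping with a factor in [K] first, so that [psi_joinE] applies. *)
have -> : (a * b * (d * f) = (a * d) * (b ^ d * f))%g.
  by rewrite -(mulgA a b) -bdf (mulgA a d).
rewrite (psi_joinE (groupM Ka Kd) (groupM Kbd Kf) Dt) (Bl Ka Kd Ht) (Bl' Kbd Kf Ht').
rewrite (psi_joinE Ka Kb Dt) (psi_joinE Kd Kf Dt).
(* As [t] commutes with [K <*> K'], [beta w t] is an untwisted 2-cocycle there. *)
have C z u v : z \in (K <*> K')%g -> beta w t z u * beta w t (z * u)%g v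
    = beta w t z (u * v)%g * beta w t u v.
  by move=> Kz; rewrite beta_cocycle (conjg_commute (ker_op_cent Kz Dt)).
have K1 z : z \in K -> z \in (K <*> K')%g by move=> Kz; rewrite -[z]mulg1 mem_joinKK.
have K1' z : z \in K' -> z \in (K <*> K')%g by move=> Kz; rewrite -[z]mul1g mem_joinKK.
have e1 := C a d (b ^ d * f)%g (K1 _ Ka).
have e2 := C d (b ^ d)%g f (K1 _ Kd).
have e3 := C b d f (K1' _ Kb).
have e4 := C a b (d * f)%g (K1 _ Ka).
have e5 := bichar_conj_swap Kd Kb Dt.
rewrite bd in e2; rewrite bdf in e1.
exact: (twisted_rearrange _ _ _ e1 e2 e3 e4 e5).
Qed.

Lemma psi_join_K a t : a \in K -> t \in ker -> psi_join a t = B a t.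
Proof.
move=> Ka Dt; have [Ht Ht' _] := ker_opP _ Dt.
by rewrite -{1}[a]mulg1 psi_joinE // beta_x1 mul1r (bichar_l1 B0' Bl') ?mulr1.
Qed.

Lemma psi_join_K' a t : a \in K' -> t \in ker -> psi_join a t = B' a t.
Proof.
move=> Ka Dt; have [Ht Ht' _] := ker_opP _ Dt.
by rewrite -{1}[a]mul1g psi_joinE // beta_1x mul1r (bichar_l1 B0 Bl) ?mul1r.
Qed.

(** Fiber sizes of the multiplication map on [K] times [K']. They enter the trace of the tensor
    product as multiplicities, and as natural numbers they stay nonzero in characteristic zero. *)
Definition decomp (g : gT) : nat :=
  \sum_(p : gT * gT | (p.1 * p.2)%g == g) (p.1 \in K) && (p.2 \in K').

Lemma decomp_gt0 g : g \in (K <*> K')%g -> (0 < decomp g)%N.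
Proof.
case/joinKKP=> u [v [Ku Kv ->]].
by rewrite /decomp (bigD1 (u, v)) //= Ku Kv.
Qed.

Lemma decomp_eq0 g : g \notin (K <*> K')%g -> decomp g = 0%N.
Proof.
move=> nKg; rewrite /decomp big1 // => -[u v] /= /eqP gE.
case: (boolP (u \in K)) => //= Ku; case: (boolP (v \in K')) => //= Kv.
by rewrite -gE mem_joinKK in nKg.
Qed.

(* Translating the decompositions of g by z in K :&: K' multiplies the sum by
   B z x / B' z x, so the sum vanishes unless x lies in the kernel. *)
Lemma sum_decomp_eq0 g x : x \in H -> x \in H' -> x \notin ker ->
  \sum_(p : gT * gT | (p.1 * p.2)%g == g)
    (if (p.1 \in K) && (p.2 \in K') then gamma w x p.1 p.2 * B p.1 x * B' p.2 x
     else 0) = 0.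
Proof.
move=> Hx Hx' nDx.
have [z [Kz Kz' Bz]] : exists z, [/\ z \in K, z \in K' & B z x != B' z x].
  apply: NNPP => noz; case/negP: nDx; apply/ker_opP; split=> // z Kz Kz'.
  by apply/eqP; apply: NNPP => /negP ne; apply: noz; exists z.
set S := \sum_(p | _) _.
suff SE : S = B z x / B' z x * S.
  have : (B z x / B' z x - 1) * S = 0 by rewrite mulrBl mul1r -SE subrr.
  move/eqP; rewrite mulf_eq0 subr_eq0 => /orP[/eqP e|/eqP //].
  by case/eqP: Bz; rewrite -[LHS](mulfVK (B0' Kz' Hx')) e mul1r.
pose f (p : gT * gT) := ((p.1 * z)%g, (z^-1 * p.2)%g).
have f_bij : bijective f.
  exists (fun p : gT * gT => ((p.1 * z^-1)%g, (z * p.2)%g)) => -[u v].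
    by rewrite /f /= mulgK mulKVg.
  by rewrite /f /= mulgKV mulKg.
rewrite {1}/S (reindex f) /=; last exact: onW_bij.
rewrite /S mulr_sumr; apply: eq_big => [p | p _].
  by rewrite mulgA mulgK.
rewrite /= (groupMr _ Kz) (groupMl _ (groupVr Kz')).
case: ifP => [/andP[Ku Kv] | _]; last by rewrite mulr0.
move: p.1 p.2 Ku Kv => u v Ku Kv.
have comK y : y \in K -> commute x y.
  by move=> Ky; apply: commute_sym; exact: commute_cent cKH Ky Hx.
have comK' y : y \in K' -> commute x y.
  by move=> Ky; apply: commute_sym; exact: commute_cent cKH' Ky Hx'.
have Kzv := groupM (groupVr Kz') Kv.
rewrite (gamma_commute w (comK _ Ku) (comK' _ Kv)).
rewrite (gamma_commute w (comK _ (groupM Ku Kz)) (comK' _ Kzv)).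
have vE : v = (z * (z^-1 * v))%g by rewrite mulKVg.
have := Bl' Kz' Kzv Hx'; rewrite -vE => ->.
have := beta_cocycle w x u z (z^-1 * v)%g.
rewrite -vE (conjg_commute (comK _ Ku)) (Bl Ku Kz Hx) => e.
transitivity (beta w x u z * beta w x (u * z)%g (z^-1 * v)%g
  * B u x * B z x * B' (z^-1 * v)%g x).
  by ring.
by rewrite e; field; exact: B0'.
Qed.

(** * The tensor product of the two universal modules *)

Section UniversalTensor.
Variables X Y : Dmod w.
Hypotheses (aX : S_acts K H B X) (aY : S_acts K' H' B' Y).
Variables (c c' : k).
Hypothesis trX : forall g x, \tr (mact X g x) =
  if (g \in K) && (x \in H) then c * B g x else 0.
Hypothesis trY : forall g x, \tr (mact Y g x) =
  if (g \in K') && (x \in H') then c' * B' g x else 0.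

(** The scalar by which [h] acts on the component [(u, v)] is [psi_join (u * v) h], which depends on
    the product alone. *)
Lemma S_acts_tens_join : S_acts (K <*> K')%G D psi_join (tens X Y).
Proof.
move=> g h Dh; have [Hh Hh' _] := ker_opP _ Dh; rewrite /= /tens_act.
transitivity (\sum_(p : gT * gT | (p.1 * p.2)%g == g)
    if g \in (K <*> K')%g
    then psi_join g h *: (mact X p.1 1%g *t mact Y p.2 1%g) else 0).
  apply: eq_bigr => -[u v] /= /eqP <-; rewrite (aX u Hh) (aY v Hh').
  have [Ku | Ku] := ifPn; last first.
    by rewrite (S_acts_eq0 aX Ku) !tens0mx !scaler0 if_same.
  have [Kv | Kv] := ifPn; last first.
    by rewrite (S_acts_eq0 aY Kv) !tensmx0 !scaler0 if_same.
  rewrite mem_joinKK // psi_joinE // tensmxZ scalerA mulrA gamma_commute //.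
    by apply: ker_op_cent Dh; rewrite -[u]mulg1 mem_joinKK.
  by apply: ker_op_cent Dh; rewrite -[v]mul1g mem_joinKK.
case: ifP => Kg; last by rewrite big1.
rewrite -scaler_sumr; congr (_ *: _); apply: eq_bigr => p _.
by rewrite gamma_1 scale1r.
Qed.

(** For [x] in the kernel all factorizations of [g] contribute equally; for other [x] in [H] and
    [H'] they cancel by [sum_decomp_eq0]. *)
Lemma mxtrace_tens_join g x : \tr (mact (tens X Y) g x) =
  if x \in ker then c * c' * (decomp g)%:R * psi_join g x else 0.
Proof.
rewrite /= /tens_act raddf_sum /=.
have E (p : gT * gT) : \tr (gamma w x p.1 p.2 *: (mact X p.1 x *t mact Y p.2 x))
    = c * c' * (if (x \in H) && (x \in H') then
        if (p.1 \in K) && (p.2 \in K') then gamma w x p.1 p.2 * B p.1 x * B' p.2 x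
        else 0 else 0).
  rewrite mxtraceZ mxtrace_tens trX trY.
  case: (p.1 \in K); case: (p.2 \in K'); case: (x \in H); case: (x \in H');
    rewrite /= ?mulr0 ?mul0r ?mulr0 //; ring.
under eq_bigr do rewrite E.
rewrite -mulr_sumr; case: ifPn => Dx.
  have [Hx Hx' _] := ker_opP _ Dx; rewrite Hx Hx' /= -!mulrA; congr (_ * (_ * _)).
  rewrite /decomp natr_sum mulr_suml; apply: eq_bigr => -[u v] /= /eqP <-.
  have [Ku|] := boolP (u \in K); last by rewrite mul0r.
  have [Kv|] := boolP (v \in K'); last by rewrite mul0r.
  rewrite mul1r psi_joinE // gamma_commute ?mulrA //.
    by apply: ker_op_cent Dx; rewrite -[u]mulg1 mem_joinKK.
  by apply: ker_op_cent Dx; rewrite -[v]mul1g mem_joinKK.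
have [Hx | _] := boolP (x \in H); last by rewrite big1 ?mulr0.
have [Hx' | _] := boolP (x \in H'); last by rewrite big1 ?mulr0.
by rewrite /= sum_decomp_eq0 ?mulr0.
Qed.

End UniversalTensor.

Lemma exists_tens_join : exists X Y : Dmod w,
  [/\ S_acts K H B X, S_acts K' H' B' Y, S_acts (K <*> K')%G D psi_join (tens X Y)
    & exists2 c : k, c != 0 & forall g x, \tr (mact (tens X Y) g x) =
        if x \in ker then c * (decomp g)%:R * psi_join g x else 0].
Proof.
have [X [aX [c c0 trX]]] := universal_mod char0 nK nH cKH bicharB invB.
have [Y [aY [c' c'0 trY]]] := universal_mod char0 nK' nH' cKH' bicharB' invB'.
exists X, Y; split=> //; first exact: S_acts_tens_join.
exists (c * c'); first by rewrite mulf_neq0.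
by move=> g x; exact: mxtrace_tens_join.
Qed.

Lemma psi_join1 g : g \in (K <*> K')%g -> psi_join g 1%g = 1.
Proof.
case/joinKKP=> u [v [Ku Kv ->]]; rewrite psi_joinE ?(group1 D) // beta_1.
by rewrite (bichar_r1 B0 Br Ku) (bichar_r1 B0' Br' Kv) !mulr1.
Qed.

(** Since all components over [K K'] are nonzero, identities between scalars can be read off from
    the action on [Z]. The next two lemmas are obtained in this way. *)
Lemma exists_faithful_join : exists2 Z : Dmod w, S_acts (K <*> K')%G D psi_join Z
  & forall g, g \in (K <*> K')%g -> mact Z g 1%g != 0.
Proof.
have [X [Y [_ _ aZ [c c0 trZ]]]] := exists_tens_join.
exists (tens X Y) => // g Kg; apply/eqP=> e0; have := trZ g 1%g.
rewrite e0 mxtrace0 (group1 D) psi_join1 // mulr1 => /esym/eqP.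
by rewrite mulf_eq0 (negPf c0) pchar0_natr_eq0 // -leqn0 leqNgt decomp_gt0.
Qed.

Lemma psi_join_mulr g s t : g \in (K <*> K')%g -> s \in D -> t \in D ->
  psi_join g (s * t)%g = (beta w g s t)^-1 * psi_join g s * psi_join g t.
Proof.
move=> Kg Ds Dt; have [Z aZ Z_neq0] := exists_faithful_join.
have gs : (g ^ s = g)%g by apply/conjg_commute/commute_sym; exact: ker_op_cent Ds.
have := mactM Z g s g t; rewrite gs eqxx (aZ g s Ds) (aZ g t Dt).
rewrite (aZ g _ (groupM Ds Dt)) Kg -scalemxAl -scalemxAr mact_idem !scalerA.
move/eqP; rewrite -subr_eq0 -scalerBl scaler_eq0 (negPf (Z_neq0 g Kg)) orbF subr_eq0.
by move/eqP=> e; rewrite -mulrA e mulrA mulVf ?mul1r // beta_neq0.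
Qed.

Lemma psi_join_inv : G_invariant w (K <*> K')%G D psi_join.
Proof.
move=> x c h Kc Dh; have [Z aZ Z_neq0] := exists_faithful_join.
have cxE : (x^-1 * c * x = c ^ x)%g by rewrite conjgE mulgA.
have Kcx : (c ^ x)%g \in (K <*> K')%g.
  by rewrite normal_memJ // normalY.
have xhE : (x * h * x^-1 = h ^ x^-1)%g by rewrite conjgE invgK mulgA.
have Dxh : (h ^ x^-1)%g \in D by rewrite normal_memJ // ker_op_normal.
(* The same triple product is evaluated twice: multiplied from the left, it shows the conjugate of
   [h] acting in degree [c]; in [e2], [h] first acts as a scalar in degree [c ^ x]. *)
have e1 : mact Z c x *m mact Z (c ^ x)%g h *m mact Z (c ^ x)%g x^-1%g
   = (beta w c x h * beta w c (x * h)%g x^-1%g * psi_join c (h ^ x^-1)%g)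
     *: mact Z c 1%g.
  rewrite mactM eqxx -scalemxAl mactM conjgM.
  rewrite (conjg_commute (commute_sym (ker_op_cent Kcx Dh))) eqxx xhE.
  by rewrite (aZ c _ Dxh) Kc !scalerA.
have e2 : mact Z c x *m mact Z (c ^ x)%g h *m mact Z (c ^ x)%g x^-1%g
   = (psi_join (c ^ x)%g h * beta w c x x^-1%g) *: mact Z c 1%g.
  rewrite (aZ _ h Dh) Kcx -scalemxAr -scalemxAl mactM1 eqxx mactM eqxx mulgV.
  by rewrite scalerA.
move: e1; rewrite e2 => /eqP.
rewrite -subr_eq0 -scalerBl scaler_eq0 (negPf (Z_neq0 c Kc)) orbF subr_eq0 => /eqP e.
rewrite cxE xhE; apply: (mulIf (beta_neq0 w c x x^-1%g)); rewrite e.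
by field; exact: beta_neq0.
Qed.

Let nKK : ((K <*> K')%G <| [set: gT])%g. Proof. exact: normalY. Qed.

Let cKKD : ((K <*> K')%G \subset 'C(D))%g.
Proof.
apply/subsetP=> x Kx; apply/centP=> t Dt.
exact/commute_sym/(ker_op_cent Kx Dt).
Qed.

Lemma S_joinE M : S_subcat w R (K * K')%g ker psi_join M <->
  S_acts (K <*> K')%G D psi_join M.
Proof.
rewrite -joinKK; split.
  exact: (S_S_acts char0 nKK ker_op_normal cKKD psi_join_neq0 psi_join_mulr psi_join_inv).
by apply: S_acts_S => //; exact: group1 D.
Qed.

Lemma S_join_fusion : fusion_subcat (S_subcat w R (K * K')%g ker psi_join).
Proof.
have [Fi Fu Fd Fs Ft Fl Fr] := S_acts_fusion cKKD psi_join_neq0 psi_join_mull.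
split.
- by move=> M N isoMN /S_joinE aM; apply/S_joinE; exact: Fi isoMN aM.
- exact/S_joinE.
- by move=> M N /S_joinE aM /S_joinE aN; apply/S_joinE; exact: Fd.
- by move=> M N /S_joinE aMN; apply/S_joinE; exact: Fs aMN.
- by move=> M N /S_joinE aM /S_joinE aN; apply/S_joinE; exact: Ft.
- by move=> M N dMN /S_joinE aM; apply/S_joinE; exact: Fl dMN aM.
by move=> M N dMN /S_joinE aM; apply/S_joinE; exact: Fr dMN aM.
Qed.

(** The same simple summands serve, since [psi_join] restricts to [B] on [K]. *)
Lemma S_sub_join :
  subcat_sub (S_subcat w R K H B) (S_subcat w R (K * K')%g ker psi_join).
Proof.
move=> M [n [N [isoM simN]]]; exists n, N; split=> // i.
have [a [chi [/setIP[Ka Ra] irr sim chiB]]] := simN i; exists a, chi; split=> //.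
  by rewrite inE Ra -[a]mulg1 mem_mulg.
by move=> h Dh; have [Hh _ _] := ker_opP _ Dh; rewrite psi_join_K // chiB.
Qed.

Lemma S_sub_join' :
  subcat_sub (S_subcat w R K' H' B') (S_subcat w R (K * K')%g ker psi_join).
Proof.
move=> M [n [N [isoM simN]]]; exists n, N; split=> // i.
have [a [chi [/setIP[Ka Ra] irr sim chiB]]] := simN i; exists a, chi; split=> //.
  by rewrite inE Ra -[a]mul1g mem_mulg.
by move=> h Dh; have [_ Hh _] := ker_opP _ Dh; rewrite psi_join_K' // chiB.
Qed.

(** Since [psi_join g x * psi_join g x^-1] cancels the cocycle, every [x] in [D] contributes [c]
    times a natural number to the pairing of the characters. This number is positive for some [g],
    as the support of [N] is nonempty and lies in [K K']. *)
Lemma simple_retract_join X Y N c : c != 0 ->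
    (forall g x, \tr (mact (tens X Y) g x) =
       if x \in ker then c * (decomp g)%:R * psi_join g x else 0) ->
  simple_mod N -> S_acts (K <*> K')%G D psi_join N -> retract N (tens X Y).
Proof.
move=> c0 trZ simN aN; apply: (simple_retract_trace char0) => //.
have E g x : (beta w g x x^-1%g)^-1 *
     (\tr (mact (tens X Y) g x) * \tr (mact N (g ^ x)%g x^-1%g))
   = if x \in D then c * (decomp g * \rank (mact N g 1%g))%N%:R else 0.
  rewrite trZ; case: ifPn => Dx; last by rewrite mul0r mulr0.
  have [Kg | nKg] := boolP (g \in (K <*> K')%g); last first.
    by rewrite decomp_eq0 ?mul0n // !(mulr0, mul0r).
  have Dx' : x^-1%g \in D by rewrite groupV.
  rewrite (conjg_commute (commute_sym (ker_op_cent Kg Dx))) (aN g _ Dx') Kg.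
  rewrite mxtraceZ mxtrace_mact1 natrM.
  have := psi_join_mulr Kg (Dx : x \in D) Dx'; rewrite mulgV psi_join1 // => e.
  by rewrite -[RHS]mulr1 [X in _ = _ * X]e; ring.
under eq_bigr => g _ do under eq_bigr => x _ do rewrite E.
under eq_bigr => g _ do rewrite -big_mkcond sumr_const.
rewrite sumrMnl -mulr_sumr -natr_sum -[X in X != 0]mulr_natr !mulf_neq0 //.
  rewrite pchar0_natr_eq0 //.
  have [g eg] := mact1_neq0 simN.1.
  have Kg : g \in (K <*> K')%g by apply: contraNT eg => /(S_acts_eq0 aN) ->.
  by rewrite (bigD1 g) //= -lt0n addn_gt0 muln_gt0 decomp_gt0 // lt0n mxrank_eq0 eg.
by rewrite pchar0_natr_eq0 // -lt0n cardG_gt0.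
Qed.

(** The right-hand side is a fusion subcategory containing both. Conversely, any [E] containing both
    contains [tens X Y], hence its retracts, among them all simple objects of the right-hand
    side. *)
Lemma S_join M : subcat_join (S_subcat w R K H B) (S_subcat w R K' H' B') M <->
  S_subcat w R (K * K')%g ker psi_join M.
Proof.
split=> [|[n [N [isoM simN]]] E fE SE SE'].
  by apply; [exact: S_join_fusion | exact: S_sub_join | exact: S_sub_join'].
have [X [Y [aX aY _ [c c0 trZ]]]] := exists_tens_join.
have EZ : E (tens X Y).
  apply: fusion_tens fE _ _ _ _.
    apply: SE; exact/(S_actsE char0 nK nH cKH bicharB invB R_repr).
  apply: SE'; exact/(S_actsE char0 nK' nH' cKH' bicharB' invB' R_repr).
apply: (fusion_iso fE (iso_sym isoM)).
elim/big_ind: _ => [|L L'|i _]; last 1 first.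
- have [a [chi [/setIP[Ka _] _ sim chiB]]] := simN i.
  apply: fusion_retract_closed fE _ _ _ EZ.
  apply: simple_retract_join trZ _ _ => //; first by case: sim.
  apply: (S_acts_simple char0 nKK ker_op_normal cKKD psi_join_neq0 psi_join_mulr
    psi_join_inv sim) _ chiB.
  by rewrite /= joinKK.
- have Z0 : retract (zero_mod w) (unit_mod w).
    exists 0, 0; split; try by move=> g x; rewrite mulmx0 mul0mx.
    by rewrite (flatmx0 (_ *m _)) (flatmx0 1%:M).
  exact: fusion_retract_closed fE _ _ Z0 (fusion_unit fE).
exact: fusion_dsum fE _ _.
Qed.

End Join.

Theorem proposition6p3 (k : closedFieldType) (char0 : [pchar k] =i pred0)
  (gT : finGroupType) (w : cocycle3 gT k)
  (R : {set gT}) (R_repr : is_transversal R (classes [set: gT]) [set: gT])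
  (K H K' H' : {group gT})
  (nK : (K <| [set: gT])%g) (nH : (H <| [set: gT])%g)
  (nK' : (K' <| [set: gT])%g) (nH' : (H' <| [set: gT])%g)
  (cKH : (K \subset 'C(H))%g) (cKH' : (K' \subset 'C(H'))%g)
  (B B' : gT -> gT -> k)
  (bicharB : bicharacter w K H B) (invB : G_invariant w K H B)
  (bicharB' : bicharacter w K' H' B') (invB' : G_invariant w K' H' B') :
  same_subcat
    (subcat_meet (S_subcat w R K H B) (S_subcat w R K' H' B'))
    (S_subcat w R (ker_phi K H B K' H' B') (H * H')%g (psi w H B H' B'))
  /\
  same_subcat
    (subcat_join (S_subcat w R K H B) (S_subcat w R K' H' B'))
    (S_subcat w R (K * K')%g
       (ker_phi H K (opf B) H' K' (opf B'))
       (opf (psi (inv_cocycle w) K (opf B) K' (opf B')))).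
Proof.
split=> M; first exact: S_meet.
exact: S_join.
Qed.
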